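(* Let $N_0\in\mathbb{N}$, suppose $\mathcal{F}$ satisfies (VC) or (BR), and let $v_n\to0$ and $d_0>0$ be the rate and constant of the strong approximation recalled in the context. Then $$\limsup_{n\rightarrow+\infty}\frac{\sqrt n}{v_n}\max_{0\leqslant N\leqslant N_0}\sup_{f\in\mathcal{F}}\left\vert\mathbb{E}\left(\mathbb{P}_n^{(N)}(f)\right)-P(f)\right\vert\leqslant d_0,$$ and, for each $0\leqslant N\leqslant N_0$, \begin{align*} &\limsup_{n\rightarrow+\infty}\frac{n}{v_n}\sup_{f,g\in\mathcal{F}}\left\vert\mathbb{E}\left((\mathbb{P}_n^{(N)}(f)-P(f))(\mathbb{P}_n^{(N)}(g)-P(g))\right)-\frac1n\mathrm{Cov}\left(\mathbb{G}^{(N)}(f),\mathbb{G}^{(N)}(g)\right)\right\vert\\ &=\limsup_{n\rightarrow+\infty}\frac{n}{v_n}\sup_{f,g\in\mathcal{F}}\left\vert\mathrm{Cov}\left(\mathbb{P}_n^{(N)}(f),\mathbb{P}_n^{(N)}(g)\right)-\frac1n\mathrm{Cov}\left(\mathbb{G}^{(N)}(f),\mathbb{G}^{(N)}(g)\right)\right\vert\leqslant\sqrt{\frac8\pi}\,d_0\,\sigma_{\mathcal{F}}. \end{align*}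
   Context: Setting. $\mathbb{N}=\{0,1,\dots\}$, $\mathbb{N}_*=\{1,2,\dots\}$. $X_1,X_2,\dots$ are i.i.d. with law $P$ on a measurable space $(\mathcal{X},\mathcal{A})$, $P(f)=\int f\,dP$. For each $N\in\mathbb{N}_*$, $\mathcal{A}^{(N)}=\{A_1^{(N)},\dots,A_{m_N}^{(N)}\}\subset\mathcal{A}$ is a finite partition of $\mathcal{X}$ with $m_N\geqslant2$ and $\min_jP(A_j^{(N)})>0$; consecutive partitions are different. Raking-ratio empirical process. $\mathbb{P}_n^{(0)}(f)=n^{-1}\sum_{i=1}^nf(X_i)$ and, for $N\in\mathbb{N}_*$, $$\mathbb{P}_n^{(N)}(f)=\sum_{j=1}^{m_N}\frac{P(A_j^{(N)})}{\mathbb{P}_n^{(N-1)}(A_j^{(N)})}\mathbb{P}_n^{(N-1)}(f1_{A_j^{(N)}}),\qquad \alpha_n^{(N)}(f)=\sqrt n\,(\mathbb{P}_n^{(N)}(f)-P(f)),\quad N\geqslant0.$$ Sets are identified with their indicators. These are well defined when all $\mathbb{P}_n^{(0)}(A_j^{(k)})>0$, $k\leqslant N$; on the complementary event (of exponentially small probability) set $\mathbb{P}_n^{(N)}=\mathbb{P}_n^{(0)}$. Class $\mathcal{F}$. $\mathcal{F}$ is a class of measurable real functions on $\mathcal{X}$ with $\sup_{f\in\mathcal{F}}|f|\leqslant M<\infty$, pointwise measurable (there is a countable $\mathcal{F}_*\subset\mathcal{F}$ such that each $f\in\mathcal{F}$ is the pointwise limit of a sequence in $\mathcal{F}_*$),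 and such that $1_A\in\mathcal{F}$ and $1_Af\in\mathcal{F}$ for all $f\in\mathcal{F}$, $A\in\mathcal{A}^{(1)}\cup\dots\cup\mathcal{A}^{(N_0)}$. $\|\cdot\|_{\mathcal{F}}$ is the supremum norm over $\mathcal{F}$; $\sigma_f^2=P(f^2)-P(f)^2$, $\sigma_{\mathcal{F}}^2=\sup_{f\in\mathcal{F}}\sigma_f^2$. With $d_Q^2(f,g)=\int(f-g)^2dQ$, let $N(\mathcal{F},\varepsilon,d_Q)$ be the minimal number of $d_Q$-balls of radius $\varepsilon$ covering $\mathcal{F}$, and $N_{[\,]}(\mathcal{F},\varepsilon,d_P)$ the minimal number of brackets $[g_-,g_+]=\{f:g_-\leqslant f\leqslant g_+\}$ with $d_P(g_-,g_+)<\varepsilon$ covering $\mathcal{F}$. (VC): for some $c_0>0,\nu_0>0$, $\sup_QN(\mathcal{F},\varepsilon,d_Q)\leqslant c_0/\varepsilon^{\nu_0}$ for $0<\varepsilon<1$, supremum over discrete probability measures $Q$. (BR): for some $b_0>0,r_0\in(0,1)$, $N_{[\,]}(\mathcal{F},\varepsilon,d_P)\leqslant\exp(b_0^2/\varepsilon^{2r_0})$ for $0<\varepsilon<1$. Gaussian processes. $\mathbb{G}=\mathbb{G}^{(0)}$ is the $P$-Brownian bridge indexed by $\mathcal{F}$: the centered Gaussian process, linear in $f$, with $\mathrm{Cov}(\mathbb{G}(f),\mathbb{G}(g))=P(fg)-P(f)P(g)$. For $N\in\mathbb{N}_*$, $$\mathbb{G}^{(N)}(f)=\mathbb{G}^{(N-1)}(f)-\sum_{j=1}^{m_N}\mathbb{E}(f|A_j^{(N)})\,\mathbb{G}^{(N-1)}(A_j^{(N)}),\qquad\mathbb{E}(f|A)=\frac{P(f1_A)}{P(A)},\quad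 \mathbb{G}^{(N)}(A)=\mathbb{G}^{(N)}(1_A).$$ Rate and constant. Under (VC), $v_n=(\log n)^\beta/n^\alpha$ with $\alpha=1/(2+5\nu_0)$, $\beta=(4+5\nu_0)/(4+10\nu_0)$; under (BR), $v_n=(\log n)^{-\gamma}$ with $\gamma=(1-r_0)/(2r_0)$. The constant $d_0>0$ is one for which the following strong approximation holds, for some $\theta_0>0$: on some probability space there are i.i.d. $X_n$ with law $P$ and versions $\mathbb{G}_n$ of $\mathbb{G}$ such that, for some $n_0$ and all $n\geqslant n_0$, $\mathbb{P}(\sup_{0\leqslant N\leqslant N_0}\|\alpha_n^{(N)}-\mathbb{G}_n^{(N)}\|_{\mathcal{F}}\geqslant d_0v_n)<n^{-\theta_0}$, where $\mathbb{G}_n^{(N)}$ is built from $\mathbb{G}_n^{(0)}=\mathbb{G}_n$ by the recursion above. (Such $d_0$ exist for every $\theta_0>0$.) *)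

(* Defs.v *)
From HB Require Import structures.
From mathcomp Require Import all_boot all_order all_algebra finmap.
From mathcomp Require Import all_classical all_reals all_analysis.

Set Implicit Arguments.
Unset Strict Implicit.
Unset Printing Implicit Defensive.

Import Order.TTheory GRing.Theory Num.Theory.
Import numFieldNormedType.Exports.

Local Open Scope classical_set_scope.
Local Open Scope ring_scope.

(* A N j is the cell of index j of the N-th partition, for N >= 1 only: nothing
   is required of, and nothing depends on, A 0. *)
Definition partition_sequence (R : realType) d (T : measurableType d)
    (P : probability T R) (m : nat -> nat) (A : forall N, 'I_(m N) -> set T) :=
  (forall N, (1 <= N)%N ->
    [/\ (2 <= m N)%N,
        forall j, measurable (A N j),
        trivIset setT (A N),
        \bigcup_j A N j = setT &
        forall j, (0 < P (A N j))%E]) /\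
  (forall N, (1 <= N)%N -> range (A N) <> range (A N.+1)).

(* The sample X_1, ..., X_n is x 0, ..., x n.-1. *)
Definition empirical (R : realType) (T : Type) (n : nat) (x : nat -> T)
    (f : T -> R) : R :=
  n%:R^-1 * \sum_(i < n) f (x i).

Definition cells_charged (R : realType) (T : Type) (m : nat -> nat)
    (A : forall N, 'I_(m N) -> set T) (n : nat) (x : nat -> T) (N : nat) :=
  forall k, (1 <= k <= N)%N -> forall j : 'I_(m k),
    0 < empirical n x (\1_(A k j) : T -> R).

(* cells_charged is decreasing in N, so when it holds at N.+1 the value at N
   comes from the recursion as well. *)
Fixpoint raked (R : realType) d (T : measurableType d) (P : probability T R)
    (m : nat -> nat) (A : forall N, 'I_(m N) -> set T) (n : nat) (x : nat -> T)
    (N : nat) (f : T -> R) : R :=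
  match N with
  | 0 => empirical n x f
  | N'.+1 =>
    if `[< cells_charged R A n x N'.+1 >] then
      \sum_(j < m N'.+1)
        fine (P (A N'.+1 j)) / raked P A n x N' \1_(A N'.+1 j)
        * raked P A n x N' (f \* \1_(A N'.+1 j))
    else empirical n x f
  end.

Definition raked_process (R : realType) d (T : measurableType d)
    (P : probability T R) (m : nat -> nat) (A : forall N, 'I_(m N) -> set T)
    (n : nat) (x : nat -> T) (N : nat) (f : T -> R) : R :=
  Num.sqrt n%:R * (raked P A n x N f - Rintegral P setT f).

Definition pointwise_measurable (R : realType) d (T : measurableType d)
    (F : set (T -> R)) :=
  (forall f, F f -> measurable_fun setT f) /\
  exists Fs : set (T -> R), [/\ Fs `<=` F, countable Fs &
    forall f, F f -> exists u : nat -> T -> R,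
      (forall n, Fs (u n)) /\ (forall x, u n x @[n --> \oo] --> f x)].

Definition stable_under_cells (R : realType) (T : Type)
    (m : nat -> nat) (A : forall N, 'I_(m N) -> set T) (N0 : nat)
    (F : set (T -> R)) :=
  forall N, (1 <= N <= N0)%N -> forall j : 'I_(m N),
    F \1_(A N j) /\ (forall f, F f -> F (\1_(A N j) \* f)).

Definition dL2 (R : realType) d (T : measurableType d) (Q : probability T R)
    (f g : T -> R) : \bar R :=
  'N[Q]_(2%:E)[(fun x => (f x - g x)%:E)]%E.

(* The centers of the balls need not belong to F. *)
Definition covering_number (R : realType) d (T : measurableType d)
    (F : set (T -> R)) (eps : R) (Q : probability T R) : \bar R :=
  ereal_inf [set (k%:R)%:E | k in [set k : nat |
    exists c : 'I_k -> T -> R,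
      (forall i, measurable_fun setT (c i)) /\
      (forall f, F f -> exists i, (dL2 Q (c i) f < eps%:E)%E)]].

Definition bracketing_number (R : realType) d (T : measurableType d)
    (F : set (T -> R)) (eps : R) (Q : probability T R) : \bar R :=
  ereal_inf [set (k%:R)%:E | k in [set k : nat |
    exists lo hi : 'I_k -> T -> R,
      (forall i, [/\ measurable_fun setT (lo i), measurable_fun setT (hi i) &
                     (dL2 Q (lo i) (hi i) < eps%:E)%E]) /\
      (forall f, F f -> exists i, forall x, lo i x <= f x <= hi i x)]].

(* Countable convex combinations of point masses; singletons of T need not be
   measurable, so this is not expressed through a countable support. *)
Definition discrete_probability (R : realType) d (T : measurableType d)
    (Q : probability T R) :=
  exists (p : nat -> R) (x : nat -> T), (forall i, 0 <= p i) /\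
    forall B, measurable B ->
      Q B = (\sum_(0 <= i <oo) (p i)%:E * \d_(x i) B)%E.

Definition VC_entropy (R : realType) d (T : measurableType d)
    (F : set (T -> R)) (c0 nu0 : R) :=
  [/\ 0 < c0, 0 < nu0 & forall eps : R, 0 < eps < 1 ->
    (ereal_sup [set covering_number F eps Q |
                  Q in [set Q : probability T R | discrete_probability Q]]
     <= (c0 / eps `^ nu0)%:E)%E].

Definition BR_entropy (R : realType) d (T : measurableType d)
    (P : probability T R) (F : set (T -> R)) (b0 r0 : R) :=
  [/\ 0 < b0, 0 < r0 < 1 & forall eps : R, 0 < eps < 1 ->
    (bracketing_number F eps P <= (expR (b0 ^+ 2 / eps `^ (2 * r0)))%:E)%E].

Definition rate_VC (R : realType) (nu0 : R) (n : nat) : R :=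
  let alpha := (2 + 5 * nu0)^-1 in
  let beta := (4 + 5 * nu0) / (4 + 10 * nu0) in
  (ln n%:R) `^ beta / n%:R `^ alpha.

Definition rate_BR (R : realType) (r0 : R) (n : nat) : R :=
  let gamma := (1 - r0) / (2 * r0) in
  (ln n%:R) `^ (- gamma).

Definition entropy_rate (R : realType) d (T : measurableType d)
    (P : probability T R) (F : set (T -> R)) (v : nat -> R) :=
  (exists c0 nu0, VC_entropy F c0 nu0 /\ v = rate_VC nu0) \/
  (exists b0 r0, BR_entropy P F b0 r0 /\ v = rate_BR r0).

Definition iid (R : realType) d dO (T : measurableType d)
    (O : measurableType dO) (Pr : probability O R) (P : probability T R)
    (X : nat -> {RV Pr >-> T}) :=
  (forall i B, measurable B -> distribution Pr (X i) B = P B) /\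
  (forall (J : {fset nat}) (B : nat -> set T),
    (forall i, measurable (B i)) ->
    Pr (\bigcap_(i in [set` J]) (X i @^-1` B i)) =
    (\prod_(i <- J) Pr (X i @^-1` B i))%E).

(* The case of zero variance is separate: normal_prob m 0 is not a point mass
   in the library. *)
Definition gaussian_rv (R : realType) dO (O : measurableType dO)
    (Pr : probability O R) (Y : O -> R) :=
  measurable_fun setT Y /\ exists mu s : R, forall B : set R, measurable B ->
    Pr (Y @^-1` B) = (if s == 0 then \d_mu B else normal_prob mu s B).

Definition gaussian_process (R : realType) dO (O : measurableType dO)
    (Pr : probability O R) (I : Type) (F : set I) (G : I -> O -> R) :=
  forall (k : nat) (a : 'I_k -> R) (t : 'I_k -> I), (forall i, F (t i)) ->
    gaussian_rv Pr (fun w => \sum_(i < k) a i * G (t i) w).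

Definition linear_process (R : realType) (T : Type) dO (O : measurableType dO)
    (Pr : probability O R) (F : set (T -> R)) (G : (T -> R) -> O -> R) :=
  forall (k : nat) (a : 'I_k -> R) (t : 'I_k -> T -> R) (f : T -> R),
    (forall i, F (t i)) -> F f -> (forall x, f x = \sum_(i < k) a i * t i x) ->
    {ae Pr, forall w, G f w = \sum_(i < k) a i * G (t i) w}.

(* G is a family over all functions T -> R of which only the members indexed
   by F matter. *)
Definition brownian_bridge (R : realType) d dO (T : measurableType d)
    (O : measurableType dO) (Pr : probability O R) (P : probability T R)
    (F : set (T -> R)) (G : (T -> R) -> O -> R) :=
  [/\ gaussian_process Pr F G,
      linear_process Pr F G,
      forall f, F f -> ('E_Pr[G f] = 0)%E &
      forall f g, F f -> F g ->
        covariance Pr (G f) (G g) =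
        (Rintegral P setT (f \* g)
         - Rintegral P setT f * Rintegral P setT g)%:E].

Definition cond_mean (R : realType) d (T : measurableType d)
    (P : probability T R) (f : T -> R) (B : set T) : R :=
  Rintegral P setT (f \* \1_B) / fine (P B).

Fixpoint raked_bridge (R : realType) d (T : measurableType d) (O : Type)
    (P : probability T R) (m : nat -> nat) (A : forall N, 'I_(m N) -> set T)
    (G : (T -> R) -> O -> R) (N : nat) (f : T -> R) (w : O) : R :=
  match N with
  | 0 => G f w
  | N'.+1 => raked_bridge P A G N' f w
    - \sum_(j < m N'.+1) cond_mean P f (A N'.+1 j)
                         * raked_bridge P A G N' \1_(A N'.+1 j) w
  end.

Definition sup_norm (R : realType) (I : Type) (F : set I) (z : I -> R) :
    \bar R :=
  ereal_sup [set `|z f|%:E | f in F].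

(* The outer measure mu_ext Pr agrees with Pr on measurable events; the supremum
   over F of a process with arbitrary paths need not be measurable. *)
Definition strong_approximation (R : realType) d (T : measurableType d)
    (P : probability T R) (m : nat -> nat) (A : forall N, 'I_(m N) -> set T)
    (N0 : nat) (F : set (T -> R)) (v : nat -> R) (d0 theta0 : R) :=
  exists dO (O : measurableType dO) (Pr : probability O R)
         (X : nat -> {RV Pr >-> T}) (G : nat -> (T -> R) -> O -> R),
    [/\ iid P X,
        forall n, brownian_bridge Pr P F (G n) &
        exists n0 : nat, forall n, (n0 <= n)%N ->
          (mu_ext Pr [set w | (d0 * v n)%:E <=
              \big[maxe/-oo]_(N < N0.+1)
                sup_norm F (fun f => raked_process P A n (X ^~ w) N f
                                     - raked_bridge P A (G n) N f w)%R]
           < (n%:R `^ (- theta0))%:E)%E].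

(* Used for uniformly bounded F only, for which this real supremum is the true
   one. *)
Definition sigma_class (R : realType) d (T : measurableType d)
    (P : probability T R) (F : set (T -> R)) : R :=
  Num.sqrt (sup [set Rintegral P setT (f \* f) - Rintegral P setT f ^+ 2
                | f in F]).

(* Main.v *)
(* The raked measure is treated directly, by linearization. With L = P_n - P,
   the deviation P_n^(N) - P is, up to a remainder, the image of L under the
   recursion that defines the bridges G^(N), and the remainder is bounded by the
   square of an envelope S, a finite sum of terms |L h| with h bounded: this is
   clear when each cell keeps at least half of its mass, and otherwise some |L h|
   is bounded below while all quantities are bounded. An exponential moment bound
   for bounded i.i.d. sums gives E S^3 = O(n^(-3/2)), uniformly over bounded h.
   Hence the bias is O(1/n) and the covariance of the raked measure is that of
   the linear part up to O(n^(-3/2)); the linear part has covariance exactly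
   Cov(G^(N) f, G^(N) g) / n, by bilinearity. Since v_n sqrt n tends to infinity
   under both entropy conditions, every upper limit in the statement is at most 0. *)
Require Import Defs.
From HB Require Import structures.
From mathcomp Require Import all_boot all_order all_algebra finmap.
From mathcomp Require Import all_classical all_reals all_analysis.
From mathcomp Require Import measurable_realfun ring lra.

Set Implicit Arguments.
Unset Strict Implicit.
Unset Printing Implicit Defensive.

Import Order.TTheory GRing.Theory Num.Theory.
Import numFieldNormedType.Exports.

Local Open Scope classical_set_scope.
Local Open Scope ring_scope.

Local Notation mean P f := (Rintegral P setT f).

(** * Bounded measurable functions *)

(** The event where some cell is empty and raking falls back on the empirical measure gets no
    separate probability estimate: the envelope is at least 1 there, so its moments already pay for
    that event. The exponent 3 is dictated by the covariance, where a remainder of size [S ^+ 2] is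
    multiplied by a deviation of size [S]. The envelope varies with f, but its moment bound depends
    only on the stage, the partitions, P and a bound M of |f|. Uniformity over F is thus obtained
    without a supremum over F under an expectation. Each raking step brings in [\1_A] and
    [f \* \1_A], so the induction runs over all measurable functions bounded by M, with M >= 1.
    Neither covariance is put in closed form. The linear part and the bridges go through one
    recursion on bilinear forms, started from the P-covariance, with a factor 1/n for the linear
    part. The equality of the two upper limits holds because, for nonempty F, both are also at least
    0. *)

Definition mbounded (R : realType) d (T : measurableType d) (f : T -> R) :=
  measurable_fun setT f /\ exists M : R, forall x, `|f x| <= M.

Section mbounded_theory.
Context (R : realType) d (T : measurableType d).
Implicit Types f g : T -> R.

Lemma mbounded_cst (c : R) : mbounded (cst c : T -> R).
Proof. by split; [exact: measurable_cst | exists `|c|]. Qed.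

Lemma mboundedD f g : mbounded f -> mbounded g -> mbounded (f \+ g).
Proof.
move=> [mf [M hM]] [mg [K hK]]; split; first exact: measurable_funD.
by exists (M + K) => x /=; rewrite (le_trans (ler_normD _ _))// lerD.
Qed.

Lemma mboundedM f g : mbounded f -> mbounded g -> mbounded (f \* g).
Proof.
move=> [mf [M hM]] [mg [K hK]]; split; first exact: measurable_funM.
by exists (M * K) => x /=; rewrite normrM ler_pM.
Qed.

Lemma mboundedZ (c : R) f : mbounded f -> mbounded (fun x => c * f x).
Proof. exact: mboundedM (mbounded_cst c). Qed.

Lemma mboundedN f : mbounded f -> mbounded (\- f).
Proof.
move=> [mf [M hM]]; split; first exact: measurable_funN.
by exists M => x /=; rewrite normrN.
Qed.

Lemma mboundedB f g : mbounded f -> mbounded g -> mbounded (f \- g).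
Proof. by move=> hf hg; exact: mboundedD hf (mboundedN hg). Qed.

Lemma mbounded_norm f : mbounded f -> mbounded (fun x => `|f x|).
Proof.
move=> [mf [M hM]]; split; first exact: measurableT_comp.
by exists M => x; rewrite normr_id.
Qed.

Lemma mboundedX f n : mbounded f -> mbounded (fun x => f x ^+ n).
Proof.
move=> [mf [M hM]]; split; first exact: measurable_funX.
by exists (M ^+ n) => x; rewrite normrX lerXn2r// nnegrE// (le_trans _ (hM x)).
Qed.

Lemma mbounded_expR f : mbounded f -> mbounded (fun x => expR (f x)).
Proof.
move=> [mf [M hM]]; split; first exact: measurableT_comp.
exists (expR M) => x; rewrite ger0_norm ?expR_ge0// ler_expR.
exact: le_trans (ler_norm _) (hM x).
Qed.

Lemma mbounded_sum I (r : seq I) (Q : pred I) (h : I -> T -> R) :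
  (forall i, Q i -> mbounded (h i)) -> mbounded (fun x => \sum_(i <- r | Q i) h i x).
Proof.
move=> hh; elim: r => [|i r IH].
  under eq_fun do rewrite big_nil; exact: mbounded_cst.
under eq_fun do rewrite big_cons.
by have [Qi|//] := boolP (Q i); exact: mboundedD (hh i Qi) IH.
Qed.

Lemma mbounded_prod I (r : seq I) (Q : pred I) (h : I -> T -> R) :
  (forall i, Q i -> mbounded (h i)) -> mbounded (fun x => \prod_(i <- r | Q i) h i x).
Proof.
move=> hh; elim: r => [|i r IH].
  under eq_fun do rewrite big_nil; exact: mbounded_cst.
under eq_fun do rewrite big_cons.
by have [Qi|//] := boolP (Q i); exact: mboundedM (hh i Qi) IH.
Qed.

Lemma mbounded_indic (B : set T) : measurable B -> mbounded (\1_B : T -> R).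
Proof.
move=> mB; split; first exact: measurable_indic.
by exists 1 => x; rewrite indicE ger0_norm ?ler0n// lern1 leq_b1.
Qed.

End mbounded_theory.
Arguments mbounded_indic {R d T B}.
Arguments mbounded_cst {R d T}.

Lemma mbounded_comp (R : realType) d d' (T : measurableType d)
    (O : measurableType d') (X : O -> T) (f : T -> R) :
  measurable_fun setT X -> mbounded f -> mbounded (f \o X).
Proof.
move=> mX [mf [M hM]]; split; first exact: measurableT_comp.
by exists M => x /=.
Qed.

Section mean_theory.
Context (R : realType) d (T : measurableType d) (P : probability T R).
Implicit Types f g : T -> R.

Lemma mbounded_integrable f : mbounded f -> P.-integrable setT (EFin \o f).
Proof.
move=> [mf [M hM]]; apply: measurable_bounded_integrable => //.
  by rewrite (le_lt_trans (probability_le1 P measurableT))// ltry.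
exists M; split; first exact: num_real.
by move=> K MK x _; exact: le_trans (hM x) (ltW MK).
Qed.

Lemma mean_EFin f : mbounded f -> (\int[P]_x (f x)%:E = (mean P f)%:E)%E.
Proof.
by move=> hf; rewrite /Rintegral fineK// integrable_fin_num// mbounded_integrable.
Qed.

Lemma mean_cst (c : R) : mean P (cst c) = c.
Proof.
rewrite Rintegral_cst// -[RHS]mulr1; congr (_ * _).
exact: (congr1 fine (probability_setT P)).
Qed.

Lemma meanD f g : mbounded f -> mbounded g ->
  mean P (fun x => f x + g x) = mean P f + mean P g.
Proof. by move=> ? ?; rewrite RintegralD//; exact: mbounded_integrable. Qed.

Lemma meanB f g : mbounded f -> mbounded g ->
  mean P (fun x => f x - g x) = mean P f - mean P g.
Proof. by move=> ? ?; rewrite RintegralB//; exact: mbounded_integrable. Qed.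

Lemma meanZ (c : R) f : mbounded f -> mean P (fun x => c * f x) = c * mean P f.
Proof. by move=> ?; rewrite RintegralZl//; exact: mbounded_integrable. Qed.

Lemma mean_sum I (r : seq I) (Q : pred I) (h : I -> T -> R) :
  (forall i, Q i -> mbounded (h i)) ->
  mean P (fun x => \sum_(i <- r | Q i) h i x) = \sum_(i <- r | Q i) mean P (h i).
Proof.
move=> hh; elim: r => [|i r IH].
  by rewrite big_nil; under eq_Rintegral do rewrite big_nil; rewrite mean_cst.
rewrite big_cons; under eq_Rintegral do rewrite big_cons.
have [Qi|//] := boolP (Q i).
by rewrite meanD ?IH//; [exact: hh | exact: mbounded_sum].
Qed.

Lemma ler_mean f g : mbounded f -> mbounded g -> (forall x, f x <= g x) ->
  mean P f <= mean P g.
Proof. by move=> ? ? ?; apply: le_Rintegral => //; exact: mbounded_integrable. Qed.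

Lemma ler_norm_mean f : mbounded f -> `|mean P f| <= mean P (fun x => `|f x|).
Proof. by move=> ?; apply: le_normr_Rintegral => //; exact: mbounded_integrable. Qed.

Lemma mean_norm_le f (M : R) : mbounded f -> (forall x, `|f x| <= M) ->
  `|mean P f| <= M.
Proof.
move=> hf hM; apply: le_trans (ler_norm_mean hf) _.
rewrite -[leRHS](mean_cst M); apply: ler_mean => //; first exact: mbounded_norm.
exact: mbounded_cst.
Qed.

Lemma mean_indic (B : set T) : measurable B -> mean P \1_B = fine (P B).
Proof. by move=> mB; rewrite /Rintegral integral_indic// setIT. Qed.

Lemma mbounded_Lfun1 f : mbounded f -> f \in Lfun P 1.
Proof. by move=> /mbounded_integrable; rewrite Lfun1_integrable. Qed.

Lemma mbounded_Lfun2 f : mbounded f -> f \in Lfun P 2%:E.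
Proof.
move=> hf; have [mf _] := hf; rewrite inE; apply/andP; split; rewrite inE//=.
rewrite /finite_norm unlock poweR_lty//.
under eq_integral => x _ do rewrite /= powR_mulrn// -normrX ger0_norm ?sqr_ge0//.
by rewrite mean_EFin ?ltry//; exact: mboundedX.
Qed.

Lemma expectation_mbounded f : mbounded f -> ('E_P[f] = (mean P f)%:E)%E.
Proof. by move=> hf; rewrite unlock mean_EFin. Qed.

Lemma covariance_mbounded f g : mbounded f -> mbounded g ->
  covariance P f g = (mean P (f \* g) - mean P f * mean P g)%:E.
Proof.
move=> hf hg; rewrite covarianceE ?mbounded_Lfun1//; last exact: mboundedM.
by rewrite !expectation_mbounded//; exact: mboundedM.
Qed.

End mean_theory.

(** * Independence as a product rule for means *)

(** The sum is e times the number of positive multiples of e that do not exceed y, that is y rounded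
    down to the grid. Written with thresholds, it becomes a combination of indicators of superlevel
    sets. *)
Lemma step_approx (R : realType) (e y : R) (n : nat) : 0 < e -> 0 <= y <= n%:R * e ->
  `|y - \sum_(k < n) e * (k.+1%:R * e <= y)%R%:R| <= e.
Proof.
move=> e0; elim: n => [|n IH] /andP[y0 yn].
  by rewrite big_ord0 subr0 ger0_norm// (le_trans yn)// mul0r ltW.
rewrite big_ord_recr/=; have [yle|ylt] := leP y (n%:R * e).
  rewrite [n.+1%:R * e <= y](_ : _ = false) ?mulr0 ?addr0 ?IH ?y0//.
  apply/negbTE; rewrite -ltNge (le_lt_trans yle)//.
  by rewrite ltr_pM2r// ltr_nat.
rewrite (eq_bigr (fun=> e)) => [|k _]; last first.
  rewrite [_ <= _](_ : _ = true) ?mulr1// (le_trans _ (ltW ylt))//.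
  by rewrite ler_pM2r// ler_nat.
rewrite sumr_const card_ord -mulr_natl.
move: yn; rewrite -natr1 mulrDl mul1r => yn.
case: (boolP (_ <= y)) => [h|]; rewrite ?mulr1 ?mulr0 ler_norml; first by lra.
by rewrite -ltNge; lra.
Qed.

(** An induction principle for bounded measurable functions: they are uniform limits of staircases
    built on superlevel sets. It serves to pass from independence of events to products of
    functions. *)
Lemma mbounded_ind (R : realType) d (T : measurableType d) (K : (T -> R) -> Prop) :
  (forall B, measurable B -> K \1_B) ->
  (forall (a : R) f g, mbounded f -> mbounded g -> K f -> K g ->
    K (fun x => a * f x + g x)) ->
  (forall f, mbounded f -> (forall e : R, 0 < e ->
    exists g, [/\ mbounded g, K g & forall x, `|f x - g x| <= e]) -> K f) ->
  forall f, mbounded f -> K f.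
Proof.
move=> Kindic Klin Kunif f hf; have [mf [M hM]] := hf.
(* The constant c is c times the indicator of the whole space plus the indicator of the empty
   set. *)
have Kcst c : K (cst c).
  have := Klin c \1_setT \1_set0 (mbounded_indic measurableT) (mbounded_indic measurable0)
    (Kindic _ measurableT) (Kindic _ measurable0).
  rewrite (_ : (fun x => _) = cst c)//; apply/funext => x.
  by rewrite !indicE in_setT in_set0 mulr1 addr0.
pose lev (e : R) (k : nat) := f @^-1` `[k.+1%:R * e - M, +oo[.
have mlev e k : measurable (lev e k).
  by rewrite -[lev e k]setTI; apply: mf => //; exact: measurable_itv.
have Kstep e n : mbounded (fun x => \sum_(k < n) e * \1_(lev e k) x - M) /\
                 K (fun x => \sum_(k < n) e * \1_(lev e k) x - M).
  elim: n => [|n [hb hK]].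
    under eq_fun do rewrite big_ord0 sub0r.
    by split; [exact: mbounded_cst | exact: Kcst].
  under eq_fun do rewrite big_ord_recr/=.
  have hi : mbounded (\1_(lev e n) : T -> R) := mbounded_indic (mlev e n).
  rewrite (_ : (fun x => _) = (fun x => e * \1_(lev e n) x
    + (\sum_(k < n) e * \1_(lev e k) x - M))); last first.
    by apply/funext => x; lra.
  split; first by exact: (mboundedD (mboundedZ e hi) hb).
  exact: Klin (Kindic _ (mlev e n)) hK.
(* The shifted function f + M takes its values between 0 and 2 * M, a range covered by [n.+1] levels
   of height e. *)
apply: Kunif => // e e0; set n := Num.truncn (2 * M / e); exists
  (fun x => \sum_(k < n.+1) e * \1_(lev e k) x - M); have [? ?] := Kstep e n.+1.
split => // x; rewrite opprB addrA.
rewrite (eq_bigr (fun k : 'I_n.+1 => e * (k.+1%:R * e <= f x + M)%R%:R)) => [|k _].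
  apply: step_approx => //; have := hM x; rewrite ler_norml => /andP[h1 h2].
  apply/andP; split; first lra.
  have /ltW : 2 * M / e < n.+1%:R by exact: truncnS_gt.
  by rewrite ler_pdivrMr//; lra.
rewrite indicE; congr (_ * (nat_of_bool _)%:R); apply/idP/idP.
  by rewrite inE /lev /= in_itv /= andbT lerBlDr.
by rewrite -lerBlDr inE /lev /= in_itv /= andbT.
Qed.

Section iid_products.
Context (R : realType) d dO (T : measurableType d) (O : measurableType dO).
Context (P : probability T R) (Pr : probability O R) (X : nat -> {RV Pr >-> T}).
Context (hX : iid P X).

Lemma mbounded_sample (h : T -> R) i : mbounded h -> mbounded (fun w => h (X i w)).
Proof. by move=> hh; apply: mbounded_comp hh. Qed.

Let prod_indic (B : nat -> set T) n : (forall i, measurable (B i)) ->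
  mean Pr (fun w => \prod_(i < n) \1_(B i) (X i w)) = \prod_(i < n) mean P \1_(B i).
Proof.
move=> mB; have [hdist hind] := hX.
(* Independence is stated for finite sets of indices, so the product over i < n is read as a product
   over J. *)
pose J := [fset i | i in iota 0 n]%fset.
have JE F : (\prod_(i <- J) F i = \prod_(i < n) F i :> \bar R)%E.
  rewrite -(big_mkord xpredT) /index_iota subn0; apply: perm_big.
  rewrite uniq_perm ?fset_uniq ?iota_uniq// => i.
  by apply/imfsetP/idP => [[j ? ->]//|hi]; exists i.
transitivity (mean Pr \1_(\bigcap_(i in [set` J]) (X i @^-1` B i))).
  apply: eq_Rintegral => w _.
  have [wB|wB] := boolP (w \in _).
    rewrite big1// => i _; rewrite indicE mem_set//.
    move: wB; rewrite inE; apply; rewrite /= /J; apply/imfsetP; exists (val i) => //=.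
    by rewrite mem_iota /= add0n.
  have /existsNP[i /not_implyP[iJ iB]] : ~ (forall i, [set` J] i -> (X i @^-1` B i) w).
    by move=> h; move/negP: wB; apply; rewrite inE.
  have [j /=] := imfsetP _ _ _ _ iJ; rewrite mem_iota add0n /= => jn ij.
  rewrite -{}ij {j} in jn; rewrite (bigD1 (Ordinal jn))//= indicE memNset ?mul0r//.
have mcap : measurable (\bigcap_(i in [set` J]) (X i @^-1` B i)).
  apply: bigcap_measurableType => i _.
  by rewrite -[X in measurable X]setTI; exact: measurable_funP.
rewrite mean_indic// hind// JE.
rewrite (eq_bigr (fun i : 'I_n => (mean P \1_(B i))%:E)) => [|i _].
  by rewrite (_ : (\prod_(i < n) _)%E = (\prod_(i < n) mean P \1_(B i))%:E)//;
    elim/big_rec2 : _ => // i x y _ ->; rewrite EFinM.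
rewrite mean_indic// fineK ?fin_num_measure//; exact: hdist.
Qed.

Lemma mean_prod (n : nat) (h : nat -> T -> R) : (forall i, mbounded (h i)) ->
  mean Pr (fun w => \prod_(i < n) h i (X i w)) = \prod_(i < n) mean P (h i).
Proof.
(* Indicators are replaced by general functions one coordinate at a time: in [H k], only the factors
   of index below k are arbitrary. *)
suff H k : forall h, (forall i, mbounded (h i)) ->
    (forall i, (k <= i)%N -> exists2 B, measurable B & h i = \1_B) ->
    mean Pr (fun w => \prod_(i < n) h i (X i w)) = \prod_(i < n) mean P (h i).
  (* Factors of index n and above do not enter the product; padding with [\1_setT] makes them
     indicators, as [H n] requires. *)
  move=> hh; pose h' i := if (i < n)%N then h i else \1_setT.
  have hE F : \prod_(i < n) F (h' i) i = \prod_(i < n) F (h i) i :> R.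
    by apply: eq_bigr => i _; rewrite /h' ltn_ord.
  have := H n h'; rewrite (hE (fun f _ => mean P f)).
  under eq_Rintegral do rewrite (hE (fun f i => f (X i _))).
  apply => i; first by rewrite /h'; case: ifP => // _; exact: mbounded_indic.
  by move=> ni; exists setT => //; rewrite /h' ltnNge ni.
elim: k => [|k IH] {}h hh hB.
  have /choice[B hB'] : forall i, exists B, measurable B /\ h i = \1_B.
    by move=> i; have [B ? ?] := hB i (leq0n i); exists B.
  have -> : h = fun i => \1_(B i) by apply/funext => i; exact: (hB' i).2.
  by apply: prod_indic => i; exact: (hB' i).1.
have [nk|kn] := leqP n k.
  pose h' i := if (i < n)%N then h i else \1_setT.
  have hE F : \prod_(i < n) F (h' i) i = \prod_(i < n) F (h i) i :> R.
    by apply: eq_bigr => i _; rewrite /h' ltn_ord.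
  have := IH h'; rewrite (hE (fun f _ => mean P f)).
  under eq_Rintegral do rewrite (hE (fun f i => f (X i _))).
  apply => i; first by rewrite /h'; case: ifP => // _; exact: mbounded_indic.
  by move=> ki; exists setT => //; rewrite /h' ltnNge (leq_trans nk).
(* With the other factors frozen in [Z] and [c], both sides are linear in the k-th factor g, and
   [mbounded_ind] applies to it. *)
pose rep g i := if i == k then g else h i.
pose Z w := \prod_(i < n | i != Ordinal kn) h i (X i w).
pose c := \prod_(i < n | i != Ordinal kn) mean P (h i).
have mZ : mbounded Z by apply: mbounded_prod => i _; exact: mbounded_sample.
have repE g : (mean Pr (fun w => \prod_(i < n) rep g i (X i w))
      = \prod_(i < n) mean P (rep g i)) <->
    mean Pr (fun w => Z w * g (X k w)) = c * mean P g.
  have E F : \prod_(i < n) F (rep g i) i =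
      \prod_(i < n | i != Ordinal kn) F (h i) i * F g (Ordinal kn) :> R.
    rewrite (bigD1 (Ordinal kn))//= /rep eqxx mulrC; congr (_ * _).
    by apply: eq_bigr => i /negbTE; rewrite -val_eqE /= => ->.
  rewrite (E (fun f _ => mean P f)).
  by under eq_Rintegral do rewrite (E (fun f i => f (X i _))).
have hk : rep (h k) = h by apply/funext => i; rewrite /rep; case: eqP => // ->.
rewrite -hk; apply/repE.
have mX g : mbounded g -> mbounded (fun w => Z w * g (X k w)).
  by move=> mg; apply: mboundedM => //; exact: mbounded_sample.
move: (h k) (hh k) {hk}.
apply: (@mbounded_ind _ _ _ (fun f =>
    mean Pr (fun w => Z w * f (X k w)) = c * mean P f)) =>
  [B mB|a f g mf mg hf hg|f mf hf].
- apply/repE; apply: IH => i; rewrite /rep.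
    by case: eqP => // _; exact: mbounded_indic.
  case: eqP => [_ _|/eqP ik ki]; first by exists B.
  by apply: hB; rewrite ltn_neqAle ki andbT eq_sym.
- transitivity (mean Pr (fun w => a * (Z w * f (X k w)) + Z w * g (X k w))).
    by apply: eq_Rintegral => w _; rewrite mulrDr mulrCA.
  have aX : mbounded (fun w => a * (Z w * f (X k w))) by apply: mboundedZ; exact: mX.
  have af : mbounded (fun x => a * f x) by exact: mboundedZ.
  rewrite (meanD _ aX (mX _ mg)) (meanZ _ _ (mX _ mf)) hf hg.
  by rewrite (meanD _ af mg) (meanZ _ _ mf) mulrDr mulrCA.
(* Closure under uniform limits: replacing f by a g within e / (|MZ| + |c| + 1) moves the two sides
   by at most e in total. The added 1 keeps the denominator positive. *)
have [MZ hMZ] := mZ.2.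
apply/eqP; rewrite -subr_eq0 -normr_le0; apply/ler_addgt0Pl => e e0.
rewrite addr0.
have K0 : 0 < `|MZ| + `|c| + 1 by rewrite ltr_wpDl// addr_ge0.
have /hf[g [mg Kg fg]] : 0 < e / (`|MZ| + `|c| + 1) by rewrite divr_gt0.
have fgX w : `|f (X k w) - g (X k w)| <= e / (`|MZ| + `|c| + 1) by exact: fg.
have mfg := mboundedB mf mg.
rewrite (_ : _ - _ = (mean Pr (fun w => Z w * f (X k w)) - mean Pr (fun w => Z w * g (X k w)))
  - c * (mean P f - mean P g)); last by rewrite Kg; ring.
rewrite -(meanB Pr (mX _ mf) (mX _ mg)) -(meanB P mf mg).
apply: le_trans (ler_normB _ _) _; rewrite normrM.
apply: (@le_trans _ _ (`|MZ| * (e / (`|MZ| + `|c| + 1)) + `|c| * (e / (`|MZ| + `|c| + 1)))).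
  apply: lerD; last first.
    by rewrite ler_wpM2l// mean_norm_le.
  apply: mean_norm_le => [|w]; first exact: mboundedB (mX _ mf) (mX _ mg).
  by rewrite -mulrBr normrM ler_pM// (le_trans (hMZ w))// ler_norm.
rewrite -mulrDl mulrCA ger_pMr// ler_pdivrMr// mul1r.
by rewrite lerDl.
Qed.

End iid_products.

(** * Moments of the centered empirical measure *)

Definition empirical_dev (R : realType) d (T : measurableType d)
    (P : probability T R) (n : nat) (x : nat -> T) (f : T -> R) : R :=
  empirical n x f - mean P f.

(** From exp(-y) >= 1 - y one gets exp(y) <= 1 / (1 - y), and (1 + y + 2 y^2)(1 - y) = 1 + y^2 (1 -
    2 y) is at least 1 in this range. *)
Lemma expR_le_quadratic (R : realType) (y : R) : `|y| <= 2^-1 ->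
  expR y <= 1 + y + 2 * y ^+ 2.
Proof.
rewrite ler_norml => /andP[y1 y2].
have := expR_ge1Dx (- y); rewrite expRN => h.
have h0 : 0 < 1 - y by lra.
have : expR y <= (1 - y)^-1 by rewrite -[expR y]invrK lef_pV2// posrE ?invr_gt0 ?expR_gt0.
move/le_trans; apply; rewrite -[leLHS]mul1r ler_pdivrMr//.
have := sqr_ge0 y; nra.
Qed.

(** Turns exponential moments of both signs into a third absolute moment; 6 is 3! from the Taylor
    term of order three. *)
Lemma cube_le_expR (R : realType) (t : R) : `|t| ^+ 3 <= 6 * (expR t + expR (- t)).
Proof.
have H (s : R) : 0 <= s -> s ^+ 3 <= 6 * expR s.
  by move=> s0; have := expR_ge1Dxn 2 s0; rewrite !factS fact0 /=; lra.
have [t0|t0] := leP 0 t.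
  by rewrite ger0_norm//; have := H _ t0; have := expR_gt0 (- t); lra.
have /H : 0 <= - t by rewrite oppr_ge0 ltW.
by rewrite ltr0_norm//; have := expR_gt0 t; lra.
Qed.

Section empirical_moments.
Context (R : realType) d dO (T : measurableType d) (O : measurableType dO).
Context (P : probability T R) (Pr : probability O R) (X : nat -> {RV Pr >-> T}).
Context (hX : iid P X).
Implicit Types f g : T -> R.

(** The pair is completed by factors equal to 1 to a product over all indices up to the larger
    one. *)
Lemma mean_sample2 f g i j : mbounded f -> mbounded g -> i != j ->
  mean Pr (fun w => f (X i w) * g (X j w)) = mean P f * mean P g.
Proof.
move=> mf mg ij; pose n := (maxn i j).+1.
have ilt : (i < n)%N by rewrite ltnS leq_maxl.
have jlt : (j < n)%N by rewrite ltnS leq_maxr.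
pose h k := if k == i then f else if k == j then g else cst 1.
have mh k : mbounded (h k).
  by rewrite /h; case: ifP => // _; case: ifP => // _; exact: mbounded_cst.
have E (F : nat -> (T -> R) -> R) : (forall k, F k (cst 1) = 1) ->
    \prod_(k < n) F k (h k) = F i f * F j g.
  move=> F1; rewrite (bigD1 (Ordinal ilt))//= (bigD1 (Ordinal jlt))/=; last first.
    by rewrite -val_eqE /= eq_sym.
  rewrite big1 ?mulr1 /h ?eqxx => [|k /andP[ki kj]].
    by rewrite eq_sym (negbTE ij).
  by rewrite -!val_eqE /= in ki kj; rewrite (negbTE ki) (negbTE kj).
have := mean_prod hX n mh; rewrite (E (fun _ f => mean P f)) => [|k]; last exact: mean_cst.
move=> <-; apply: eq_Rintegral => w _.
by rewrite (E (fun k f => f (X k w))).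
Qed.

Lemma mean_sample f i : mbounded f -> mean Pr (fun w => f (X i w)) = mean P f.
Proof.
move=> mf; rewrite -[RHS]mulr1 -(mean_cst P 1).
rewrite -(@mean_sample2 _ _ i i.+1 mf (mbounded_cst 1)) ?neq_ltn ?ltnSn//.
by apply: eq_Rintegral => w _; rewrite mulr1.
Qed.

Lemma mbounded_empirical_dev n f : mbounded f ->
  mbounded (fun w => empirical_dev P n (X ^~ w) f).
Proof.
move=> mf; have h : mbounded (fun w => n%:R^-1 * \sum_(i < n) f (X i w)).
  by apply: mboundedZ; apply: mbounded_sum => i _; exact: (mbounded_sample X i mf).
exact: (mboundedB h (mbounded_cst (mean P f))).
Qed.

Let ctr f x := f x - mean P f.

Let mctr f : mbounded f -> mbounded (ctr f).
Proof. by move=> mf; apply: mboundedB mf (mbounded_cst _). Qed.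

Let mean_ctr f : mbounded f -> mean P (ctr f) = 0.
Proof. by move=> mf; rewrite meanB// ?mean_cst ?subrr//; exact: mbounded_cst. Qed.

Let devE n f w : (0 < n)%N ->
  empirical_dev P n (X ^~ w) f = n%:R^-1 * \sum_(i < n) ctr f (X i w).
Proof.
move=> n0; rewrite /ctr sumrB sumr_const card_ord mulrBr; congr (_ - _).
by rewrite -(mulr_natl (mean P f)) mulKf// pnatr_eq0 -lt0n.
Qed.

Lemma mean_empirical_dev n f : (0 < n)%N -> mbounded f ->
  mean Pr (fun w => empirical_dev P n (X ^~ w) f) = 0.
Proof.
move=> n0 mf; under eq_Rintegral do rewrite devE//.
have ms (i : 'I_n) : mbounded (fun w => ctr f (X i w)).
  exact: (mbounded_sample X i (mctr mf)).
rewrite meanZ ?mean_sum//; last by apply: mbounded_sum.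
by rewrite big1 ?mulr0// => i _; rewrite mean_sample ?mean_ctr//; exact: mctr.
Qed.

Lemma mean_empirical_dev2 n f g : (0 < n)%N -> mbounded f -> mbounded g ->
  mean Pr (fun w => empirical_dev P n (X ^~ w) f * empirical_dev P n (X ^~ w) g)
  = n%:R^-1 * (mean P (f \* g) - mean P f * mean P g).
Proof.
move=> n0 mf mg.
transitivity (mean Pr (fun w => n%:R^-1 ^+ 2 *
    \sum_(i < n) \sum_(j < n) ctr f (X i w) * ctr g (X j w))).
  apply: eq_Rintegral => w _; rewrite !devE//.
  by under [in RHS]eq_bigr do rewrite -mulr_sumr; rewrite -mulr_suml; ring.
have ms (i j : 'I_n) : mbounded (fun w => ctr f (X i w) * ctr g (X j w)).
  exact: (mboundedM (mbounded_sample X i (mctr mf)) (mbounded_sample X j (mctr mg))).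
have ms1 (i : 'I_n) : mbounded (fun w => \sum_(j < n) ctr f (X i w) * ctr g (X j w)).
  by apply: mbounded_sum.
rewrite meanZ ?mean_sum//; last by apply: mbounded_sum.
have cfg : mean P (fun x => ctr f x * ctr g x) = mean P (f \* g) - mean P f * mean P g.
  transitivity (mean P (fun x => (f x * ctr g x - mean P f * ctr g x))).
    by apply: eq_Rintegral => x _; rewrite -mulrBl.
  rewrite meanB; [|exact: mboundedM (mctr mg)|exact: mboundedZ (mctr mg)].
  rewrite meanZ ?mean_ctr ?mulr0 ?subr0//; last exact: mctr.
  transitivity (mean P (fun x => f x * g x - mean P g * f x)).
    by apply: eq_Rintegral => x _; rewrite mulrBr (mulrC (f x) (mean P g)).
  by rewrite meanB ?meanZ ?(mulrC (mean P g))//; [exact: mboundedM|exact: mboundedZ].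
rewrite (eq_bigr (fun=> mean P (f \* g) - mean P f * mean P g)) => [|i _].
  rewrite sumr_const card_ord -(mulr_natl (_ - _)); field.
  by rewrite pnatr_eq0 -lt0n.
rewrite mean_sum// (bigD1 i)//= (mean_sample _ (mboundedM (mctr mf) (mctr mg))) /= cfg.
rewrite big1 ?addr0// => j ji; rewrite mean_sample2 ?mean_ctr ?mul0r//.
- exact: mctr.
- exact: mctr.
- by rewrite eq_sym.
Qed.

(** By independence the mean is an n-th power. Since y is centered, each factor is at most 1 + 2 E
    y^2 <= 1 + 1/n <= exp(1/n). *)
Lemma mean_expR_sum_le n y : (0 < n)%N -> mbounded y -> mean P y = 0 ->
  (forall x, `|y x| <= (2 * Num.sqrt n%:R)^-1) ->
  mean Pr (fun w => expR (\sum_(i < n) y (X i w))) <= expR 1.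
Proof.
move=> n0 my y0 hy.
have n0R : 0 < n%:R :> R by rewrite ltr0n.
have sq1 : 1 <= Num.sqrt n%:R :> R.
  by rewrite -[leLHS]sqrtr1 ler_wsqrtr// ler1n.
under eq_Rintegral do rewrite expR_sum.
rewrite (mean_prod hX n (fun=> mbounded_expR my)).
rewrite prodr_const card_ord 
  -[in leRHS](mulfV (lt0r_neq0 n0R)) expRM_natl.
rewrite lerXn2r ?nnegrE ?expR_ge0//.
  by apply: Rintegral_ge0 => x _; exact: expR_ge0.
have my2 := mboundedZ 2 (mboundedX 2 my).
have my1 := mboundedD (mbounded_cst 1) my.
apply: (@le_trans _ _ (mean P (fun x => 1 + y x + 2 * y x ^+ 2))).
  apply: ler_mean => [||x]; [exact: mbounded_expR|exact: mboundedD my1 my2|].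
  apply: expR_le_quadratic; apply: le_trans (hy x) _.
  by rewrite lef_pV2 ?posrE ?mulr_gt0// ?ler_peMr// (lt_le_trans ltr01).
rewrite (meanD _ my1 my2) (meanD _ (mbounded_cst 1) my) mean_cst y0 addr0.
apply: le_trans (expR_ge1Dx _); rewrite lerD2l.
apply: le_trans (ler_norm _) _; apply: mean_norm_le => // x.
rewrite normrM normrX ger0_norm//.
apply: (@le_trans _ _ (2 * (2 * Num.sqrt n%:R)^-1 ^+ 2)).
  by rewrite ler_pM2l// lerXn2r// nnegrE// (le_trans _ (hy x)).
rewrite exprVn exprMn sqr_sqrtr ?ler0n// expr2 !invfM.
have n1 : 0 < n%:R^-1 :> R by rewrite invr_gt0.
by lra.
Qed.

Lemma mean_empirical_dev3 n f M : (0 < n)%N -> 0 < M -> measurable_fun setT f ->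
  (forall x, `|f x| <= M) ->
  mean Pr (fun w => (Num.sqrt n%:R * `|empirical_dev P n (X ^~ w) f|) ^+ 3)
  <= (4 * M) ^+ 3 * (12 * expR 1).
Proof.
move=> n0 M0 mf hM; have bf : mbounded f by split; [|exists M].
have n0R : 0 < n%:R :> R by rewrite ltr0n.
have s0 : 0 < Num.sqrt n%:R :> R by rewrite sqrtr_gt0.
have hc x : `|ctr f x| <= 2 * M.
  rewrite /ctr (le_trans (ler_normB _ _))// mulrDl mul1r lerD//.
  exact: mean_norm_le.
(* As |f - P f| <= 2 M, this factor brings the summands down to the size 1 / (2 sqrt n) required by
   [mean_expR_sum_le]. The scaled deviation is then 4 M times the absolute value of the normalized
   sum, and 12 = 6 * 2 counts both signs of the exponent. *)
pose a := (4 * M * Num.sqrt n%:R)^-1.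
have a0 : 0 < a by rewrite invr_gt0 !mulr_gt0.
have key (s : R) : `|s| = 1 ->
    mean Pr (fun w => expR (\sum_(i < n) s * a * ctr f (X i w))) <= expR 1.
  move=> s1; apply: (mean_expR_sum_le (y := fun x => s * a * ctr f x)) => //.
  - by apply: mboundedZ; exact: mctr.
  - by rewrite meanZ ?mean_ctr ?mulr0//; exact: mctr.
  - move=> x; rewrite 2!normrM s1 mul1r gtr0_norm//.
    apply: (@le_trans _ _ (a * (2 * M))); first by rewrite ler_pM2l.
    rewrite /a le_eqVlt; apply/orP; left; apply/eqP; field.
    by rewrite !gt_eqF.
have tE w : Num.sqrt n%:R * `|empirical_dev P n (X ^~ w) f| =
    4 * M * `|\sum_(i < n) a * ctr f (X i w)|.
  have ni : 0 < n%:R^-1 :> R by rewrite invr_gt0.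
  rewrite devE// -mulr_sumr !normrM (gtr0_norm a0) (gtr0_norm ni) mulrA [in RHS]mulrA.
  congr (_ * _); rewrite /a -[X in _ * X^-1](sqr_sqrtr (ltW n0R)); field.
  by rewrite !gt_eqF.
under eq_Rintegral do rewrite tE exprMn.
have mS s : mbounded (fun w => \sum_(i < n) s * a * ctr f (X i w)).
  by apply: mbounded_sum => i _; apply: mboundedZ;
    exact: (mbounded_sample X i (mctr bf)).
have mS1 : mbounded (fun w => \sum_(i < n) a * ctr f (X i w)).
  by apply: mbounded_sum => i _; apply: mboundedZ;
    exact: (mbounded_sample X i (mctr bf)).
have mS3 := mboundedX 3 (mbounded_norm mS1).
rewrite (meanZ _ _ mS3) ler_pM2l ?exprn_gt0 ?mulr_gt0//.
have e1 := mbounded_expR (mS 1); have e2 := mbounded_expR (mS (-1)).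
apply: (@le_trans _ _ (mean Pr (fun w => 6 * (expR (\sum_(i < n) 1 * a * ctr f (X i w))
    + expR (\sum_(i < n) (-1) * a * ctr f (X i w)))))).
  apply: ler_mean => // [|w]; first exact: mboundedZ (mboundedD e1 e2).
  have -> : \sum_(i < n) 1 * a * ctr f (X i w) = \sum_(i < n) a * ctr f (X i w).
    by apply: eq_bigr => i _; rewrite mul1r.
  have -> : \sum_(i < n) -1 * a * ctr f (X i w) = - \sum_(i < n) a * ctr f (X i w).
    by rewrite -sumrN; apply: eq_bigr => i _; rewrite mulN1r mulNr.
  exact: cube_le_expR.
rewrite (meanZ _ _ (mboundedD e1 e2)) (meanD _ e1 e2).
have := key 1 (normr1 _); have := key (-1) (normrN1 _); lra.
Qed.

End empirical_moments.

(** * The raked measure and one raking step *)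

Section raking.
Context (R : realType) d (T : measurableType d) (P : probability T R).
Context (m : nat -> nat) (A : forall N, 'I_(m N) -> set T).
Arguments A : clear implicits.
Context (hA : partition_sequence P A).
Implicit Types (f : T -> R) (x : nat -> T).

Lemma cell_measurable N j : measurable (A N.+1 j).
Proof. by have [_ + _ _ _] := hA.1 N.+1 isT; exact. Qed.

Lemma cell_prob_gt0 N j : 0 < fine (P (A N.+1 j)).
Proof.
have [_ _ _ _ /(_ j) h] := hA.1 N.+1 isT.
by rewrite -lte_fin fineK// fin_num_measure//; exact: cell_measurable.
Qed.

Lemma sum_cells_indic N y : \sum_(j < m N.+1) \1_(A N.+1 j) y = 1 :> R.
Proof.
have [_ _ tA cA _] := hA.1 N.+1 isT.
have [j _ jy] : (\bigcup_j A N.+1 j) y by rewrite cA.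
rewrite (bigD1 j)//= big1 => [|k kj]; first by rewrite indicE mem_set// addr0.
rewrite indicE memNset// => ky; move/eqP: kj; apply.
by apply: tA => //; exists y.
Qed.

Lemma mean_cells N f : mbounded f ->
  \sum_(j < m N.+1) mean P (f \* \1_(A N.+1 j)) = mean P f.
Proof.
move=> mf; rewrite -mean_sum => [|j _].
  by apply: eq_Rintegral => y _ /=; rewrite -mulr_sumr sum_cells_indic mulr1.
apply: mboundedM => //; apply: mbounded_indic; exact: cell_measurable.
Qed.

Lemma sum_cell_prob N : \sum_(j < m N.+1) fine (P (A N.+1 j)) = 1.
Proof.
rewrite -[RHS](mean_cst P) -(mean_cells N (mbounded_cst 1)).
apply: eq_bigr => j _; rewrite -mean_indic; last exact: cell_measurable.
by apply: eq_Rintegral => y _ /=; rewrite mul1r.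
Qed.

(** Strictly positive weights charge B as soon as some sample point lies in it, whatever their
    values. Empirical and raked masses of a cell are therefore positive together. *)
Lemma sum_indic_gt0 n (p : 'I_n -> R) x (B : set T) : (forall i, 0 < p i) ->
  (0 < \sum_(i < n) p i * \1_B (x i)) = [exists i : 'I_n, `[< B (x i) >]].
Proof.
move=> p0; have t0 (i : 'I_n) : 0 <= p i * \1_B (x i).
  by rewrite mulr_ge0 ?(ltW (p0 _))// indicE ler0n.
apply/idP/existsP => [h|[i /asboolP Bi]].
  apply: contrapT => /forallNP nB; move: h; rewrite big1 ?ltxx// => i _.
  by rewrite indicE memNset ?mulr0// => Bi; apply: (nB i); exact/asboolP.
rewrite (bigD1 i)//= ltr_pwDl ?sumr_ge0//.
by rewrite indicE mem_set// mulr1.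
Qed.

(** Every sample point lies in exactly one cell, and raking multiplies its weight by the positive
    ratio of that cell; the fallback has weights 1/n. Linearity in f and the bound |P_n^(N) f| <=
    sup |f| follow without any lower bound on the cell masses. *)
Lemma raked_weights n x N : (0 < n)%N -> exists p : 'I_n -> R,
  [/\ forall i, 0 < p i, \sum_(i < n) p i = 1 &
      forall f, raked P A n x N f = \sum_(i < n) p i * f (x i)].
Proof.
move=> n0; have n0R : 0 < n%:R :> R by rewrite ltr0n.
have base : exists p : 'I_n -> R, [/\ forall i, 0 < p i, \sum_(i < n) p i = 1 &
    forall f, empirical n x f = \sum_(i < n) p i * f (x i)].
  exists (fun=> n%:R^-1); split => [i||f]; first by rewrite invr_gt0.
    by rewrite sumr_const card_ord -(mulr_natl _^-1) mulfV// lt0r_neq0.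
  by rewrite /empirical mulr_sumr.
elim: N => [//|N [p [p0 p1 pE]]] /=; case: asboolP => // charged.
pose c j := fine (P (A N.+1 j)) / \sum_(i < n) p i * \1_(A N.+1 j) (x i).
have q0 j : 0 < \sum_(i < n) p i * \1_(A N.+1 j) (x i).
  have := charged N.+1 (ltnSn N) j; rewrite /empirical mulr_sumr.
  by rewrite !sum_indic_gt0// => i; rewrite invr_gt0.
have c0 j : 0 < c j by rewrite divr_gt0// cell_prob_gt0.
have cE f : \sum_(i < n) p i * (\sum_(j < m N.+1) c j * \1_(A N.+1 j) (x i)) * f (x i)
    = \sum_(j < m N.+1) c j * \sum_(i < n) p i * (f (x i) * \1_(A N.+1 j) (x i)).
  under [RHS]eq_bigr do rewrite mulr_sumr.
  rewrite exchange_big; apply: eq_bigr => i _ /=.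
  rewrite -mulrA mulr_suml mulr_sumr; apply: eq_bigr => j _; ring.
exists (fun i => p i * (\sum_(j < m N.+1) c j * \1_(A N.+1 j) (x i))); split.
- move=> i; rewrite mulr_gt0//.
  have [_ _ _ cA _] := hA.1 N.+1 isT.
  have [j _ jx] : (\bigcup_j A N.+1 j) (x i) by rewrite cA.
  rewrite (bigD1 j)//= ltr_pwDl//; first by rewrite indicE mem_set// mulr1.
  by apply: sumr_ge0 => k _; rewrite mulr_ge0 ?(ltW (c0 _))// indicE ler0n.
- rewrite -[LHS](eq_bigr _ (fun i _ => mulr1 _)) (cE (cst 1)) -[RHS](sum_cell_prob N).
  apply: eq_bigr => j _ /=.
  rewrite (eq_bigr (fun i => p i * \1_(A N.+1 j) (x i))) => [|i _].
    by rewrite divfK// lt0r_neq0.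
  by rewrite /= mul1r.
by move=> f; rewrite cE; apply: eq_bigr => j _; rewrite !pE.
Qed.

Lemma raked_cells n x N f : (0 < n)%N ->
  \sum_(j < m N.+1) raked P A n x N (f \* \1_(A N.+1 j)) = raked P A n x N f.
Proof.
move=> n0; have [p [_ _ pE]] := raked_weights x N n0.
under eq_bigr do rewrite pE; rewrite exchange_big pE; apply: eq_bigr => i _ /=.
by rewrite -mulr_sumr -mulr_sumr sum_cells_indic mulr1.
Qed.

Lemma raked_norm_le n x N f M : (0 < n)%N -> (forall y, `|f y| <= M) ->
  `|raked P A n x N f| <= M.
Proof.
move=> n0 hM; have [p [p0 p1 ->]] := raked_weights x N n0.
apply: le_trans (ler_norm_sum _ _ _) _.
rewrite -[leRHS]mul1r -p1 mulr_suml; apply: ler_sum => i _.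
by rewrite normrM gtr0_norm// ler_pM2l.
Qed.

Lemma cells_chargedS n x N : (0 < n)%N -> cells_charged R A n x N ->
  (forall j, 0 < raked P A n x N \1_(A N.+1 j)) -> cells_charged R A n x N.+1.
Proof.
move=> n0 charged q0 k /andP[k1]; rewrite leq_eqVlt ltnS => /predU1P[->|kN] j.
  have := q0 j; have [p [p0 _ ->]] := raked_weights x N n0.
  rewrite /empirical mulr_sumr !sum_indic_gt0// => i.
  by rewrite invr_gt0 ltr0n.
by apply: charged; rewrite k1.
Qed.

Definition raked_dev n x N f := raked P A n x N f - mean P f.

Lemma raked_dev_cells n x N f : (0 < n)%N -> mbounded f ->
  \sum_(j < m N.+1) raked_dev n x N (f \* \1_(A N.+1 j)) = raked_dev n x N f.
Proof. by move=> n0 mf; rewrite sumrB raked_cells// mean_cells. Qed.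

(** An exact identity. With every ratio p_j / q_j replaced by 1 it is the recursion of the bridges,
    so the error of linearization comes from p_j / q_j - 1 multiplied by a deviation. *)
Lemma raked_devS n x N f : (0 < n)%N -> mbounded f -> cells_charged R A n x N.+1 ->
  (forall j, raked P A n x N \1_(A N.+1 j) != 0) ->
  raked_dev n x N.+1 f = \sum_(j < m N.+1)
    fine (P (A N.+1 j)) / raked P A n x N \1_(A N.+1 j) *
    (raked_dev n x N (f \* \1_(A N.+1 j))
     - cond_mean P f (A N.+1 j) * raked_dev n x N \1_(A N.+1 j)).
Proof.
move=> n0 mf charged q0; rewrite {1}/raked_dev /=; case: asboolP => // _.
rewrite -(mean_cells N mf) -sumrB; apply: eq_bigr => j _.
rewrite /raked_dev /cond_mean mean_indic; last exact: cell_measurable.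
by field; rewrite q0 lt0r_neq0//; exact: cell_prob_gt0.
Qed.

Lemma raked_dev_norm_le n x N f M : (0 < n)%N -> measurable_fun setT f ->
  (forall y, `|f y| <= M) -> `|raked_dev n x N f| <= 2 * M.
Proof.
move=> n0 mf hM; rewrite (le_trans (ler_normB _ _))// mulrDl mul1r.
rewrite lerD//; first exact: raked_norm_le.
by apply: mean_norm_le => //; split => //; exists M.
Qed.

Lemma cond_mean_norm_le N j f M : measurable_fun setT f ->
  (forall y, `|f y| <= M) -> `|cond_mean P f (A N.+1 j)| <= M.
Proof.
move=> mf hM; have mc := @cell_measurable N j.
have mi : mbounded (\1_(A N.+1 j) : T -> R) by exact: mbounded_indic.
have mb : mbounded f by split => //; exists M.
have p0 := @cell_prob_gt0 N j.
rewrite normrM normfV (gtr0_norm p0) ler_pdivrMr// -mean_indic// -meanZ//.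
apply: le_trans (ler_norm_mean _ (mboundedM mb mi)) _.
apply: ler_mean => [||y]; [exact/mbounded_norm/mboundedM|exact: mboundedZ|].
by rewrite normrM ler_pM// indicE ger0_norm.
Qed.

End raking.

(* The linear part of raked_dev. *)
Definition raked_lin (R : realType) d (T : measurableType d) (P : probability T R)
    (m : nat -> nat) (A : forall N, 'I_(m N) -> set T) (n : nat) (x : nat -> T)
    (N : nat) (f : T -> R) : R :=
  raked_bridge P A (fun f x => empirical_dev P n x f) N f x.

Section raking_step.
Context (R : realType) d (T : measurableType d) (P : probability T R).
Context (m : nat -> nat) (A : forall N, 'I_(m N) -> set T).
Arguments A : clear implicits.
Context (hA : partition_sequence P A).
Implicit Types (f : T -> R) (x : nat -> T).

Lemma raked_linS n x N f : raked_lin P A n x N.+1 f = raked_lin P A n x N f -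
  \sum_(j < m N.+1) cond_mean P f (A N.+1 j) * raked_lin P A n x N \1_(A N.+1 j).
Proof. by []. Qed.

Lemma indic_norm_le (B : set T) (M : R) y : 1 <= M -> `|\1_B y| <= M :> R.
Proof.
by move=> M1; rewrite indicE ger0_norm ?ler0n// (le_trans _ M1)// lern1 leq_b1.
Qed.

(** A crude deterministic bound, for samples on which the linearization says nothing. *)
Lemma raked_lin_norm_le N (M : R) : 1 <= M -> exists2 b, 0 <= b &
  forall n x f, (0 < n)%N -> measurable_fun setT f -> (forall y, `|f y| <= M) ->
  `|raked_lin P A n x N f| <= b.
Proof.
move=> M1; have M0 : 0 <= M by lra.
elim: N => [|N [b b0 hb]].
  exists (2 * M) => [|n x f n0 mf hM]; first lra.
  exact: (raked_dev_norm_le hA x 0 n0 mf hM).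
exists (b + (m N.+1)%:R * (M * b)) => [|n x f n0 mf hM].
  by rewrite addr_ge0// !mulr_ge0// ler0n.
rewrite raked_linS (le_trans (ler_normB _ _))// lerD ?hb//.
rewrite (le_trans (ler_norm_sum _ _ _))//.
rewrite -[X in X%:R * _]card_ord mulr_natl -sumr_const; apply: ler_sum => j _.
rewrite normrM ler_pM//; first exact: (cond_mean_norm_le hA).
apply: hb => // [|y]; first by apply: measurable_indic; exact: (cell_measurable hA).
exact: indic_norm_le.
Qed.

(* If all cells carry at least half of their mass, the remainder is quadratic in
   the previous deviations; if not, U is bounded below and the crude bounds
   on both terms suffice. *)
Lemma raking_step N (M : R) : 1 <= M -> exists2 K, 0 <= K &
  forall n x f (s : R) (s1 s2 : 'I_(m N.+1) -> R), (0 < n)%N ->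
    measurable_fun setT f -> (forall y, `|f y| <= M) ->
    0 <= s -> (forall j, 0 <= s1 j) -> (forall j, 0 <= s2 j) ->
    (~ cells_charged R A n x N -> 1 <= s) ->
    `|raked_lin P A n x N f| <= s ->
    `|raked_dev P A n x N f - raked_lin P A n x N f| <= s ^+ 2 ->
    (forall j, `|raked_dev P A n x N (f \* \1_(A N.+1 j))| <= s1 j) ->
    (forall j, `|raked_dev P A n x N \1_(A N.+1 j)| <= s2 j) ->
    (forall j, `|raked_lin P A n x N \1_(A N.+1 j)| <= s2 j) ->
    (forall j, `|raked_dev P A n x N \1_(A N.+1 j)
                 - raked_lin P A n x N \1_(A N.+1 j)| <= s2 j ^+ 2) ->
    let U := s + (\sum_j s1 j + \sum_j s2 j) in
    [/\ ~ cells_charged R A n x N.+1 -> 1 <= K * U,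
        `|raked_lin P A n x N.+1 f| <= K * U,
        `|raked_dev P A n x N.+1 f| <= K * U &
        `|raked_dev P A n x N.+1 f - raked_lin P A n x N.+1 f| <= (K * U) ^+ 2].
Proof.
move=> M1; have M0 : 0 <= M by lra.
have [b b0 hb] := raked_lin_norm_le N.+1 M1.
pose p j := fine (P (A N.+1 j)).
have p0 j : 0 < p j by exact: (cell_prob_gt0 hA).
(* One constant that dominates 1 and every 1 / p_j. *)
pose V := 1 + \sum_j (p j)^-1.
have VE : V = 1 + \sum_j (p j)^-1 by [].
have pV j : (p j)^-1 <= V.
  rewrite VE (bigD1 j)//= addrCA lerDl addr_ge0// sumr_ge0// => k _.
  by rewrite invr_ge0 ltW.
have V1 : 1 <= V by rewrite VE lerDl sumr_ge0// => k _; rewrite invr_ge0 ltW.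
clearbody V; clear VE.
(* The factor 2 V lifts U above 1 in the bad case; the other factor then covers the crude bounds 2 M
   for the deviation and b for the linear part. *)
pose K := (2 * M + b + 1) * (2 * V).
have K0 : 0 <= K by rewrite mulr_ge0//; lra.
exists K => // n x f s s1 s2 n0 mf hM s0 s10 s20 uncharged hl hr h1 h2 hl2 hr2 U.
have S1 : 0 <= \sum_j s1 j by apply: sumr_ge0.
have S2 : 0 <= \sum_j s2 j by apply: sumr_ge0.
have sU : s <= U by rewrite /U; lra.
have s1U : \sum_j s1 j <= U by rewrite /U; lra.
have s2U : \sum_j s2 j <= U by rewrite /U; lra.
have U0 : 0 <= U by lra.
have s2jU j : s2 j <= U.
  by apply: le_trans s2U; rewrite (bigD1 j)//= lerDl sumr_ge0.
have cm j : `|cond_mean P f (A N.+1 j)| <= M by exact: (cond_mean_norm_le hA).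
have MU : M * U <= K * U by rewrite ler_wpM2r// /K; nra.
have lin : `|raked_lin P A n x N.+1 f| <= K * U.
  apply: le_trans MU; rewrite raked_linS (le_trans (ler_normB _ _))//.
  apply: (@le_trans _ _ (s + \sum_j M * s2 j)).
    rewrite lerD// (le_trans (ler_norm_sum _ _ _))// ler_sum// => j _.
    by rewrite normrM ler_pM.
  by rewrite -mulr_sumr /U; nra.
have mb : mbounded f by split => //; exists M.
have [bad|good] := pselect ((exists j, p j / 2 < s2 j) \/ ~ cells_charged R A n x N).
  (* Either U exceeds p_j / 2 for some j, hence 1 / (2 V), or the previous stage is uncharged and
     already 1 <= s <= U. *)
  have VU : 1 <= 2 * V * U.
    case: bad => [[j pj]|/uncharged]; last by nra.
    have : p j / 2 <= U by exact: le_trans (ltW pj) (s2jU j).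
    have : 1 <= V * p j by rewrite -ler_pdivrMr// mul1r.
    by nra.
  have dev : `|raked_dev P A n x N.+1 f| <= 2 * M by exact: (raked_dev_norm_le hA).
  have KVU : K * U = (2 * M + b + 1) * (2 * V * U) by rewrite /K; ring.
  have KU : 2 * M + b + 1 <= K * U by rewrite KVU; nra.
  split => //; [by lra|by lra|].
  apply: (@le_trans _ _ (2 * M + b)); last by nra.
  by rewrite (le_trans (ler_normB _ _))// lerD// hb.
have charged : cells_charged R A n x N.
  by apply: contrapT => h; apply: good; right.
have half j : s2 j <= p j / 2.
  by rewrite leNgt; apply/negP => h; apply: good; left; exists j.
pose q j := raked P A n x N \1_(A N.+1 j).
have devq j : raked_dev P A n x N \1_(A N.+1 j) = q j - p j.
  by rewrite /raked_dev mean_indic//; exact: (cell_measurable hA).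
have qp j : p j / 2 <= q j.
  have := le_trans (h2 j) (half j).
  by rewrite devq ler_norml => /andP[+ _]; lra.
have q0 j : 0 < q j by apply: lt_le_trans (qp j); have := p0 j; lra.
have chargedS : cells_charged R A n x N.+1 by exact: (cells_chargedS hA).
have qinv j : (q j)^-1 <= 2 * (p j)^-1.
  have : (q j)^-1 <= (p j / 2)^-1 by rewrite lef_pV2// posrE// divr_gt0.
  by rewrite invfM invrK mulrC.
pose e j := raked_dev P A n x N (f \* \1_(A N.+1 j))
     - cond_mean P f (A N.+1 j) * raked_dev P A n x N \1_(A N.+1 j).
have eb j : `|e j| <= M * (s1 j + s2 j).
  rewrite /e [leRHS]mulrDr; apply: le_trans (ler_normB _ _) _; apply: lerD.
    by apply: le_trans (h1 j) _; rewrite ler_peMl.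
  by rewrite normrM ler_pM.
have devE : raked_dev P A n x N.+1 f = \sum_j p j / q j * e j.
  apply: (raked_devS hA) => // j; exact: lt0r_neq0 (q0 j).
(* The bridge recursion applied to the true deviation, because the deviations on the cells add up to
   that of f. *)
have linE : \sum_j e j = raked_dev P A n x N f
    - \sum_j cond_mean P f (A N.+1 j) * raked_dev P A n x N \1_(A N.+1 j).
  by rewrite sumrB (raked_dev_cells hA).
clearbody e.
have sum_eb : \sum_j M * (s1 j + s2 j) <= M * U.
  by rewrite -mulr_sumr big_split /= ler_wpM2l// /U; lra.
split => //.
  apply: (@le_trans _ _ (2 * (M * U))); last first.
    by rewrite mulrA ler_wpM2r// /K; nra.
  rewrite devE (le_trans (ler_norm_sum _ _ _))//.
  apply: le_trans (ler_wpM2l _ sum_eb) => //.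
  rewrite mulr_sumr ler_sum// => j _.
  rewrite normrM ler_pM// gtr0_norm ?divr_gt0//.
  by rewrite ler_pdivrMr//; have := qp j; lra.
(* The new remainder is the bridge recursion applied to the old remainder, plus the error made by
   replacing p_j / q_j by 1. The last part is a product of two first-order quantities, since p_j /
   q_j - 1 = -(q_j - p_j) / q_j. *)
have -> : raked_dev P A n x N.+1 f - raked_lin P A n x N.+1 f =
    (raked_dev P A n x N f - raked_lin P A n x N f)
    - \sum_j cond_mean P f (A N.+1 j) * (raked_dev P A n x N \1_(A N.+1 j)
                 - raked_lin P A n x N \1_(A N.+1 j))
    + \sum_j (p j / q j - 1) * e j.
  rewrite raked_linS devE.
  under [X in _ = _ - X + _]eq_bigr do rewrite mulrBr.
  under [X in _ = _ + X]eq_bigr do rewrite mulrBl mul1r.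
  by rewrite !sumrB linE; ring.
apply: (@le_trans _ _ (s ^+ 2 + \sum_j M * s2 j ^+ 2 + 2 * V * U * (M * U))).
  apply: le_trans (ler_normD _ _) _; apply: lerD.
    apply: le_trans (ler_normB _ _) _; apply: lerD => //.
    rewrite (le_trans (ler_norm_sum _ _ _))// ler_sum// => j _.
    by rewrite normrM ler_pM.
  rewrite (le_trans (ler_norm_sum _ _ _))//.
  apply: (@le_trans _ _ (2 * V * U * (\sum_j M * (s1 j + s2 j)))); last first.
    by rewrite ler_wpM2l// mulr_ge0//; lra.
  rewrite mulr_sumr ler_sum// => j _; rewrite normrM ler_pM//.
  have -> : p j / q j - 1 = - (q j - p j) * (q j)^-1.
    by field; exact: lt0r_neq0.
  rewrite normrM normrN (gtr0_norm (_ : 0 < (q j)^-1)) ?invr_gt0//.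
  rewrite -devq mulrC ler_pM// ?invr_ge0 ?(ltW (q0 j))//.
    by apply: le_trans (qinv j) _; rewrite ler_pM2l.
  exact: le_trans (h2 j) (s2jU j).
have sq : \sum_j M * s2 j ^+ 2 <= M * ((\sum_j s2 j) * U).
  rewrite -mulr_sumr ler_wpM2l// mulr_suml ler_sum// => j _.
  by rewrite expr2 ler_wpM2l.
apply: (@le_trans _ _ ((M + 2 * V * M) * U ^+ 2)).
  have h1' : s ^+ 2 <= M * (s * U).
    apply: (@le_trans _ _ (s * U)); first by rewrite expr2 ler_wpM2l.
    by rewrite ler_peMl// mulr_ge0.
  have h2' : M * ((s + \sum_j s2 j) * U) <= M * (U * U).
    by rewrite ler_wpM2l// ler_wpM2r// /U; lra.
  rewrite (_ : (M + 2 * V * M) * U ^+ 2 = M * (U * U) + 2 * V * U * (M * U)); last by ring.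
  by rewrite lerD2r; lra.
rewrite exprMn ler_wpM2r ?sqr_ge0//.
have : M + 2 * V * M <= K by rewrite /K; nra.
have : 1 <= K by rewrite /K; nra.
by nra.
Qed.

End raking_step.

(** * Envelopes *)

Section envelopes.
Context (R : realType) d dO (T : measurableType d) (O : measurableType dO).
Context (P : probability T R) (Pr : probability O R) (X : nat -> {RV Pr >-> T}).
Context (hX : iid P X).
Context (m : nat -> nat) (A : forall N, 'I_(m N) -> set T).
Arguments A : clear implicits.
Context (hA : partition_sequence P A).

(** The factor sqrt n makes C independent of n. Nonnegativity of S lets the cube stand for an
    absolute third moment. *)
Definition envelope (C : R) (n : nat) (S : O -> R) :=
  [/\ mbounded S, forall w, 0 <= S w &
      mean Pr (fun w => (Num.sqrt n%:R * S w) ^+ 3) <= C].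

Lemma mbounded_scaled_cube n (S : O -> R) : mbounded S ->
  mbounded (fun w => (Num.sqrt n%:R * S w) ^+ 3).
Proof. by move=> mS; apply: mboundedX; exact: mboundedZ. Qed.

Lemma envelopeD C1 C2 n S1 S2 : envelope C1 n S1 -> envelope C2 n S2 ->
  envelope (4 * (C1 + C2)) n (fun w => S1 w + S2 w).
Proof.
move=> [b1 p1 h1] [b2 p2 h2]; split => [|w|]; first exact: mboundedD.
  by rewrite addr_ge0.
have c1 := mbounded_scaled_cube n b1; have c2 := mbounded_scaled_cube n b2.
apply: (@le_trans _ _ (mean Pr (fun w => 4 * ((Num.sqrt n%:R * S1 w) ^+ 3
    + (Num.sqrt n%:R * S2 w) ^+ 3)))).
  apply: ler_mean => [||w].
  - exact: mbounded_scaled_cube (mboundedD b1 b2).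
  - exact: mboundedZ (mboundedD c1 c2).
  rewrite mulrDr.
  have : 0 <= Num.sqrt n%:R * S1 w by rewrite mulr_ge0.
  have : 0 <= Num.sqrt n%:R * S2 w by rewrite mulr_ge0.
  move: (_ * S1 w) (_ * S2 w) => a b b0 a0.
  (* Convexity of the cube: 4 (a^3 + b^3) - (a + b)^3 = 3 (a + b) (a - b)^2. *)
  have : 0 <= (a + b) * (a - b) ^+ 2 by rewrite mulr_ge0 ?sqr_ge0 ?addr_ge0.
  by nra.
by rewrite (meanZ _ _ (mboundedD c1 c2)) (meanD _ c1 c2) ler_pM2l// lerD.
Qed.

Lemma envelopeZ K C n S : 0 <= K -> envelope C n S ->
  envelope (K ^+ 3 * C) n (fun w => K * S w).
Proof.
move=> K0 [b p h]; split => [|w|]; [exact: mboundedZ|by rewrite mulr_ge0|].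
under eq_Rintegral do rewrite mulrCA exprMn.
by rewrite (meanZ _ _ (mbounded_scaled_cube n b)) ler_wpM2l// exprn_ge0.
Qed.

Lemma envelope_sum k C : exists C', forall n (S : 'I_k -> O -> R),
  (forall i, envelope C n (S i)) -> envelope C' n (fun w => \sum_i S i w).
Proof.
elim: k => [|k [C' IH]].
  exists 0 => n S _; under eq_fun do rewrite big_ord0.
  split => //; first exact: mbounded_cst.
  by under eq_Rintegral do rewrite mulr0 expr0n; rewrite mean_cst.
exists (4 * (C' + C)) => n S hS; under eq_fun do rewrite big_ord_recr /=.
exact: envelopeD (IH _ (fun i => S (widen_ord (leqnSn k) i)) (fun i => hS _)) (hS _).
Qed.

Lemma indicM_norm_le (f : T -> R) (B : set T) (M : R) y : `|f y| <= M ->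
  `|(f \* \1_B) y| <= M.
Proof.
by move=> hM; rewrite normrM (le_trans _ hM)// ler_piMr//; exact: indic_norm_le.
Qed.

(** Induction on the stage: the next envelope is a multiple of the sum of those of f, of the
    [f \* \1_A] and of the [\1_A]. All of these are bounded by M, so one C serves every f. *)
Lemma raked_envelope N (M : R) : 1 <= M -> exists C, forall n (f : T -> R), (0 < n)%N ->
  measurable_fun setT f -> (forall y, `|f y| <= M) -> exists S, envelope C n S /\
    forall w, let x := X ^~ w in
      [/\ ~ cells_charged R A n x N -> 1 <= S w,
          `|raked_lin P A n x N f| <= S w,
          `|raked_dev P A n x N f| <= S w &
          `|raked_dev P A n x N f - raked_lin P A n x N f| <= S w ^+ 2].
Proof.
move=> M1; have M0 : 0 < M by lra.
elim: N => [|N [C IH]].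
  exists ((4 * M) ^+ 3 * (12 * expR 1)) => n f n0 mf hM.
  have mb : mbounded f by split => //; exists M.
  exists (fun w => `|empirical_dev P n (X ^~ w) f|); split.
    split => //; first exact/mbounded_norm/mbounded_empirical_dev.
    exact: (mean_empirical_dev3 hX).
  move=> w x; split => //; last by rewrite subrr normr0 sqr_ge0.
  (* At stage 0 no cell has to be charged, so the uncharged event is empty. *)
  by case => k; rewrite leqn0 => /andP[/[swap] /eqP ->].
have [C' hC'] := envelope_sum (m N.+1) C.
have [K K0 hK] := raking_step hA N M1.
exists (K ^+ 3 * (4 * (C + 4 * (C' + C')))) => n f n0 mf hM.
have [s [es hs]] := IH n f n0 mf hM.
have mi j : measurable_fun setT (\1_(A N.+1 j) : T -> R).
  by apply: measurable_indic; exact: (cell_measurable hA).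
have hi (j : 'I_(m N.+1)) y : `|\1_(A N.+1 j) y| <= M by exact: indic_norm_le.
have /choice[s1 hs1] := fun j => IH n (f \* \1_(A N.+1 j)) n0
  (measurable_funM mf (mi j)) (fun y => @indicM_norm_le f (A N.+1 j) M y (hM y)).
have /choice[s2 hs2] := fun j => IH n \1_(A N.+1 j) n0 (mi j) (hi j).
exists (fun w => K * (s w + (\sum_j s1 j w + \sum_j s2 j w))); split.
  apply: envelopeZ => //; apply: envelopeD => //.
  by apply: envelopeD; apply: hC' => j; [have [] := hs1 j|have [] := hs2 j].
move=> w x; have [u l e r] := hs w.
apply: hK => //.
- by have [] := es.
- by move=> j; have [[]] := hs1 j.
- by move=> j; have [[]] := hs2 j.
- by move=> j; have [_ /(_ w)[]] := hs1 j.
- by move=> j; have [_ /(_ w)[]] := hs2 j.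
- by move=> j; have [_ /(_ w)[]] := hs2 j.
- by move=> j; have [_ /(_ w)[]] := hs2 j.
Qed.

Lemma measurable_charged n N :
  measurable [set w | cells_charged R A n (X ^~ w) N].
Proof.
rewrite (_ : [set w | _] = \bigcap_(k in [set k | (1 <= k <= N)%N])
   \bigcap_(j in [set: 'I_(m k)])
   [set w | 0 < empirical n (X ^~ w) (\1_(A k j) : T -> R)]); last first.
  by apply/seteqP; split => w /= h k hk; [move=> j _|move=> j]; exact: h.
apply: bigcap_measurableType => -[//|k] _.
apply: fin_bigcap_measurable; first exact: finite_finset.
move=> j _; have me : measurable_fun setT
    (fun w => empirical n (X ^~ w) (\1_(A k.+1 j) : T -> R)).
  suff [] : mbounded (fun w => empirical n (X ^~ w) (\1_(A k.+1 j) : T -> R)) by [].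
  apply: mboundedZ; apply: mbounded_sum => i _; apply: (mbounded_sample X i).
  by apply: mbounded_indic; exact: (cell_measurable hA).
rewrite (_ : [set w | _] = (fun w => empirical n (X ^~ w) (\1_(A k.+1 j) : T -> R))
  @^-1` `]0, +oo[).
  by rewrite -[X in measurable X]setTI; apply: me => //; exact: measurable_itv.
by apply/seteqP; split => w /=; rewrite in_itv /= andbT.
Qed.

Lemma mbounded_raked n N f : (0 < n)%N -> mbounded f ->
  mbounded (fun w => raked P A n (X ^~ w) N f).
Proof.
move=> n0 [mf [M hM]]; split; last first.
  by exists M => w; exact: (raked_norm_le hA).
have me g : measurable_fun setT g ->
    measurable_fun setT (fun w => empirical n (X ^~ w) g).
  move=> mg; apply: measurable_funM => //.
  by apply: measurable_sum => i; apply: measurableT_comp.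
elim: N f mf {M hM} => [|N IH] f mf /=; first exact: me.
apply: measurable_fun_ifT; [| |exact: me].
  apply: (measurable_fun_bool true); rewrite setTI.
  rewrite (_ : _ @^-1` _ = [set w | cells_charged R A n (X ^~ w) N.+1]).
    exact: measurable_charged.
  by apply/seteqP; split => w /= /asboolP.
apply: measurable_sum => j.
have mi : measurable_fun setT (\1_(A N.+1 j) : T -> R).
  by apply: measurable_indic; exact: (cell_measurable hA).
apply: measurable_funM; last by apply: IH; exact: measurable_funM.
apply: measurable_funM; first exact: measurable_cst.
(* The inverse is read as the real power -1, a measurable function; the two agree on nonnegative
   numbers, and the raked mass is nonnegative. *)
rewrite (_ : (fun w => _) = (fun w => raked P A n (X ^~ w) N \1_(A N.+1 j) `^ (-1))).
  by apply: (measurableT_comp (measurable_powR (-1))); exact: IH.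
apply/funext => w; rewrite powR_inv1//.
have [p [p0 _ ->]] := raked_weights hA (X ^~ w) N n0.
by rewrite sumr_ge0// => i _; rewrite mulr_ge0 ?(ltW (p0 _))// indicE ler0n.
Qed.

End envelopes.

(** * Covariance of the bridges *)

Section bridge_covariance.
Context (R : realType) d (T : measurableType d) (P : probability T R).
Context (m : nat -> nat) (A : forall N, 'I_(m N) -> set T).
Arguments A : clear implicits.

(** The covariance recursion of the raked bridges for an arbitrary starting form c: [row] corrects
    the second argument by its conditional means on the cells, and the last line corrects the
    first. *)
Fixpoint raked_form (c : (T -> R) -> (T -> R) -> R) (N : nat) (f g : T -> R) : R :=
  match N with
  | 0 => c f g
  | N'.+1 =>
    let c' := raked_form c N' in
    let a f j := cond_mean P f (A N'.+1 j) in
    let row f := c' f g - \sum_(j < m N'.+1) a g j * c' f \1_(A N'.+1 j) in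
    row f - \sum_(i < m N'.+1) a f i * row \1_(A N'.+1 i)
  end.

Lemma raked_formZ (k : R) c N f g :
  raked_form (fun f g => k * c f g) N f g = k * raked_form c N f g.
Proof.
elim: N f g => [//|N IH] f g /=; rewrite !IH.
have rowE h : k * raked_form c N h g
    - \sum_(j < m N.+1) cond_mean P g (A N.+1 j)
        * raked_form (fun f g => k * c f g) N h \1_(A N.+1 j)
  = k * (raked_form c N h g - \sum_(j < m N.+1) cond_mean P g (A N.+1 j)
        * raked_form c N h \1_(A N.+1 j)).
  rewrite mulrBr mulr_sumr; congr (_ - _).
  by apply: eq_bigr => j _; rewrite IH mulrCA.
rewrite rowE [RHS]mulrBr [in RHS]mulr_sumr; congr (_ - _); apply: eq_bigr => i _.
by rewrite IH rowE mulrCA.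
Qed.

Context dO (O : measurableType dO) (Pr : probability O R).

Lemma Lfun2_sum k (a : 'I_k -> R) (Y : 'I_k -> O -> R) :
  (forall j, Y j \in Lfun Pr 2%:E) -> (fun w => \sum_j a j * Y j w) \in Lfun Pr 2%:E.
Proof.
move=> hY; rewrite (_ : (fun w => _) = \sum_j (a j \*: Y j)).
  by apply: rpred_sum => [|le12 j _]; [exact: lee1n|apply: rpredZ].
by apply/funext => w; rewrite fct_sumE.
Qed.

Lemma covariance_suml k (a : 'I_k -> R) (Y : 'I_k -> O -> R) (Z : O -> R) (c : 'I_k -> R) :
  (forall j, Y j \in Lfun Pr 2%:E) -> Z \in Lfun Pr 2%:E ->
  (forall j, covariance Pr (Y j) Z = (c j)%:E) ->
  covariance Pr (fun w => \sum_j a j * Y j w) Z = (\sum_j a j * c j)%:E.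
Proof.
have Pfin : Pr setT \is a fin_num := fin_num_measure Pr _ measurableT.
move=> + hZ; elim: k a Y c => [|k IH] a Y c hY hc.
  rewrite big_ord0 (_ : (fun w => _) = cst 0) ?covariance_cst_l//.
  by apply/funext => w; rewrite big_ord0.
rewrite (_ : (fun w => _) = (fun w => \sum_(j < k) a (widen_ord (leqnSn k) j) *
    Y (widen_ord (leqnSn k) j) w) \+ (a ord_max \o* Y ord_max)); last first.
  by apply/funext => w; rewrite big_ord_recr /= [Y ord_max w * _]mulrC.
rewrite covarianceDl//; last 2 first.
- by apply: Lfun2_sum => j.
- by apply: Lfun_scale => //; rewrite ler1n.
rewrite (IH _ _ (fun j => c (widen_ord (leqnSn k) j)))//.
rewrite (covarianceZl _ (Lfun_subset12 Pfin (hY _)) (Lfun_subset12 Pfin hZ)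
  (Lfun2_mul_Lfun1 (hY _) hZ)).
by rewrite hc big_ord_recr.
Qed.

Context (F : set (T -> R)) (G : (T -> R) -> O -> R) (c : (T -> R) -> (T -> R) -> R).
Context (hG : forall f, F f -> G f \in Lfun Pr 2%:E).
Context (hc : forall f g, F f -> F g -> covariance Pr (G f) (G g) = (c f g)%:E).

Lemma raked_bridge_Lfun2 N f : (forall k, (1 <= k <= N)%N -> forall j, F \1_(A k j)) ->
  F f -> raked_bridge P A G N f \in Lfun Pr 2%:E.
Proof.
elim: N f => [|N IH] f hF Ff; first exact: hG.
have hF' k : (1 <= k <= N)%N -> forall j, F \1_(A k j).
  by move=> /andP[k1 kN]; apply: hF; rewrite k1 ltnW.
rewrite (_ : raked_bridge _ _ _ _ _ = raked_bridge P A G N f -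
  (fun w => \sum_(j < m N.+1) cond_mean P f (A N.+1 j)
    * raked_bridge P A G N \1_(A N.+1 j) w))//.
apply: rpredB => [|le12|le12]; [exact: lee1n|exact: IH|].
by apply: Lfun2_sum => j; apply: IH => //; apply: hF => /=.
Qed.

(** Only f, g and the cell indicators enter the recursion, so square integrability and covariances
    on a set F containing the indicators suffice. It applies to G on the given class and to the
    empirical deviations on all bounded measurable functions. *)
Lemma covariance_raked_bridge N f g :
  (forall k, (1 <= k <= N)%N -> forall j, F \1_(A k j)) -> F f -> F g ->
  covariance Pr (raked_bridge P A G N f) (raked_bridge P A G N g)
  = (raked_form c N f g)%:E.
Proof.
elim: N f g => [|N IH] f g hF Ff Fg; first exact: hc.
have hF' k : (1 <= k <= N)%N -> forall j, F \1_(A k j).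
  by move=> /andP[k1 kN]; apply: hF; rewrite k1 ltnW.
have FA j : F \1_(A N.+1 j) by apply: hF => /=.
have L h : F h -> raked_bridge P A G N h \in Lfun Pr 2%:E by exact: raked_bridge_Lfun2.
have bE h : raked_bridge P A G N.+1 h = raked_bridge P A G N h \-
  (fun w => \sum_(j < m N.+1) cond_mean P h (A N.+1 j)
    * raked_bridge P A G N \1_(A N.+1 j) w) by [].
have LS h : (fun w => \sum_(j < m N.+1) cond_mean P h (A N.+1 j)
    * raked_bridge P A G N \1_(A N.+1 j) w) \in Lfun Pr 2%:E.
  by apply: Lfun2_sum => j; exact: L.
have row h : F h -> covariance Pr (raked_bridge P A G N h) (raked_bridge P A G N.+1 g)
    = (raked_form c N h g - \sum_(j < m N.+1) cond_mean P g (A N.+1 j)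
        * raked_form c N h \1_(A N.+1 j))%:E.
  move=> Fh; rewrite bE covarianceBr ?L ?LS// IH// covarianceC.
  rewrite (covariance_suml _ (c := fun j => raked_form c N h \1_(A N.+1 j))) ?L//.
    by move=> j; exact: L.
  by move=> j; rewrite covarianceC IH.
rewrite [in X in covariance Pr X]bE covarianceBl ?L ?LS ?raked_bridge_Lfun2// row//.
rewrite (covariance_suml _ (c := fun i => raked_form c N \1_(A N.+1 i) g
  - \sum_(j < m N.+1) cond_mean P g (A N.+1 j)
        * raked_form c N \1_(A N.+1 i) \1_(A N.+1 j))) ?raked_bridge_Lfun2//.
- by move=> j; exact: L.
- by move=> j; exact: row.
Qed.

End bridge_covariance.

(** * Moments of the raked measure *)

Section raked_moments.
Context (R : realType) d dO (T : measurableType d) (O : measurableType dO).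
Context (P : probability T R) (Pr : probability O R) (X : nat -> {RV Pr >-> T}).
Context (hX : iid P X).
Context (m : nat -> nat) (A : forall N, 'I_(m N) -> set T).
Arguments A : clear implicits.
Context (hA : partition_sequence P A).

(** In [raked_lin] the sample itself is the outcome; here the recursion is moved to the underlying
    probability space. *)
Lemma raked_lin_bridge n N f w : raked_lin P A n (X ^~ w) N f =
  raked_bridge P A (fun f w => empirical_dev P n (X ^~ w) f) N f w.
Proof.
elim: N f => [//|N IH] f; rewrite raked_linS /= -IH; congr (_ - _).
by apply: eq_bigr => j _; rewrite IH.
Qed.

Let mi N j : mbounded (\1_(A N.+1 j) : T -> R).
Proof. by apply: mbounded_indic; exact: (cell_measurable hA). Qed.

Lemma mbounded_raked_lin n N f : mbounded f ->
  mbounded (fun w => raked_lin P A n (X ^~ w) N f).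
Proof.
elim: N f => [|N IH] f mf; first exact: mbounded_empirical_dev.
apply: mboundedB (IH _ mf) _; apply: mbounded_sum => j _.
by apply: mboundedZ; apply: IH.
Qed.

Lemma mean_raked_lin n N f : (0 < n)%N -> mbounded f ->
  mean Pr (fun w => raked_lin P A n (X ^~ w) N f) = 0.
Proof.
move=> n0; elim: N f => [|N IH] f mf; first exact: (mean_empirical_dev hX).
under eq_Rintegral do rewrite raked_linS.
have mH g : mbounded g -> mbounded (fun w => raked_lin P A n (X ^~ w) N g).
  exact: mbounded_raked_lin.
have mZ (j : 'I_(m N.+1)) : mbounded (fun w => cond_mean P f (A N.+1 j)
    * raked_lin P A n (X ^~ w) N \1_(A N.+1 j)).
  by apply: mboundedZ; exact: mH.
rewrite (meanB _ (mH _ mf))//; last exact: mbounded_sum.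
rewrite IH// mean_sum// big1 ?subrr// => j _.
by rewrite (meanZ _ _ (mH _ _))// IH// mulr0.
Qed.

Definition bridge_cov (f g : T -> R) := mean P (f \* g) - mean P f * mean P g.

(** The linear part is centered, so this mean is a covariance, and the empirical deviations have
    covariance [bridge_cov] divided by n. *)
Lemma mean_raked_lin2 n N f g : (0 < n)%N -> mbounded f -> mbounded g ->
  mean Pr (fun w => raked_lin P A n (X ^~ w) N f * raked_lin P A n (X ^~ w) N g)
  = n%:R^-1 * raked_form P A bridge_cov N f g.
Proof.
move=> n0 mf mg; rewrite -raked_formZ; apply: EFin_inj.
have mdev h : mbounded h -> mbounded (fun w => empirical_dev P n (X ^~ w) h).
  exact: mbounded_empirical_dev.
rewrite -(@covariance_raked_bridge _ _ _ P m A _ _ Pr (fun f : T -> R => mbounded f)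
  (fun f w => empirical_dev P n (X ^~ w) f)) //; last first.
- by move=> [//|k] _ j; exact: mi.
- move=> h k mh mk; rewrite (covariance_mbounded Pr (mdev _ mh) (mdev _ mk)).
  rewrite -(mean_empirical_dev2 hX n0 mh mk) -[in RHS](subr0 (Rintegral _ _ _)).
  by congr (_ - _)%:E; rewrite (mean_empirical_dev hX n0 mh) mul0r.
- by move=> h mh; apply: mbounded_Lfun2; exact: mdev.
have E h : raked_bridge P A (fun f w => empirical_dev P n (X ^~ w) f) N h
    = fun w => raked_lin P A n (X ^~ w) N h.
  by apply/funext => w; rewrite raked_lin_bridge.
rewrite !E (covariance_mbounded Pr (mbounded_raked_lin n N mf) (mbounded_raked_lin n N mg)).
rewrite -[in LHS](subr0 (Rintegral _ _ _)); congr (_ - _)%:E.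
by rewrite mean_raked_lin ?mul0r.
Qed.

Lemma mbounded_raked_dev n N f : (0 < n)%N -> mbounded f ->
  mbounded (fun w => raked_dev P A n (X ^~ w) N f).
Proof.
move=> n0 mf; apply: mboundedB (mbounded_cst (mean P f)).
exact: mbounded_raked.
Qed.

(** With t = sqrt n S, this is t^2 <= t^3 + 1. *)
Lemma envelope_sqr C n S : (0 < n)%N -> envelope Pr C n S ->
  mean Pr (fun w => S w ^+ 2) <= (C + 1) / n%:R.
Proof.
move=> n0 [mS S0 h]; have n0R : 0 < n%:R :> R by rewrite ltr0n.
rewrite ler_pdivlMr// mulrC -(meanZ _ _ (mboundedX 2 mS)).
have c3 := mbounded_scaled_cube n mS.
apply: le_trans (_ : mean Pr (fun w => (Num.sqrt n%:R * S w) ^+ 3 + 1) <= _).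
  apply: ler_mean => [||w]; first exact: mboundedZ (mboundedX 2 mS).
    exact: mboundedD c3 (mbounded_cst 1).
  rewrite -[X in X * _](sqr_sqrtr (ltW n0R)) -exprMn.
  have : 0 <= Num.sqrt n%:R * S w by rewrite mulr_ge0.
  move: (_ * S w) => t t0; have [t1|/ltW t1] := leP t 1.
    apply: (@le_trans _ _ 1); first by rewrite expr_le1.
    by rewrite lerDr exprn_ge0.
  rewrite -[leLHS]addr0 lerD//.
  by rewrite (exprS t 2) ler_peMl// exprn_ge0.
by rewrite (meanD _ c3 (mbounded_cst 1)) mean_cst lerD2r.
Qed.

(** With a and b the scaled envelopes, a^2 b is at most the cube of the larger one, hence at most
    a^3 + b^3. *)
Lemma envelope_mixed C n S1 S2 : (0 < n)%N -> envelope Pr C n S1 -> envelope Pr C n S2 ->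
  mean Pr (fun w => S1 w ^+ 2 * S2 w) <= 2 * C / (n%:R * Num.sqrt n%:R).
Proof.
move=> n0 [m1 p1 h1] [m2 p2 h2]; have n0R : 0 < n%:R :> R by rewrite ltr0n.
have s0 : 0 < Num.sqrt n%:R :> R by rewrite sqrtr_gt0.
rewrite ler_pdivlMr ?mulr_gt0// mulrC.
have m12 := mboundedM (mboundedX 2 m1) m2.
rewrite -(meanZ _ _ m12).
have c1 := mbounded_scaled_cube n m1; have c2 := mbounded_scaled_cube n m2.
apply: le_trans (_ : mean Pr (fun w => (Num.sqrt n%:R * S1 w) ^+ 3
    + (Num.sqrt n%:R * S2 w) ^+ 3) <= _).
  apply: ler_mean => [||w]; [exact: mboundedZ|exact: mboundedD|].
  rewrite -{1}(sqr_sqrtr (ltW n0R)) /=.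
  rewrite [leLHS](_ : _ = (Num.sqrt n%:R * S1 w) ^+ 2 * (Num.sqrt n%:R * S2 w)); last by ring.
  have : 0 <= Num.sqrt n%:R * S1 w by rewrite mulr_ge0// ltW.
  have : 0 <= Num.sqrt n%:R * S2 w by rewrite mulr_ge0// ltW.
  move: (_ * S1 w) (_ * S2 w) => a b b0 a0.
  have [ab|/ltW ba] := leP a b.
    apply: (@le_trans _ _ (b ^+ 3)); last by rewrite lerDr exprn_ge0.
    by rewrite (exprSr b) ler_wpM2r// lerXn2r.
  apply: (@le_trans _ _ (a ^+ 3)); last by rewrite lerDl exprn_ge0.
  by rewrite (exprSr a) ler_wpM2l ?exprn_ge0.
by rewrite (meanD _ c1 c2); lra.
Qed.

Lemma raked_moments N (M : R) : 1 <= M -> exists2 C, 0 <= C &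
  forall n (f g : T -> R), (0 < n)%N ->
    measurable_fun setT f -> (forall y, `|f y| <= M) ->
    measurable_fun setT g -> (forall y, `|g y| <= M) ->
    `|mean Pr (fun w => raked_dev P A n (X ^~ w) N f)| <= C / n%:R /\
    `|mean Pr (fun w => raked_dev P A n (X ^~ w) N f * raked_dev P A n (X ^~ w) N g)
      - n%:R^-1 * raked_form P A bridge_cov N f g| <= C / (n%:R * Num.sqrt n%:R).
Proof.
move=> M1; have [C hC] := raked_envelope hX hA N M1.
(* C bounds a moment of a nonnegative envelope of the zero function, taken at n = 1. *)
have C0 : 0 <= C.
  have z y : `|(cst 0 : T -> R) y| <= M by rewrite normr0; lra.
  have [S [[_ S0 h] _]] := hC 1 (cst 0) isT (@measurable_cst _ _ T R setT 0) z.
  by apply: le_trans h; apply: Rintegral_ge0 => w _; rewrite exprn_ge0// mulr_ge0.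
exists (4 * C + 1) => [|n f g n0 mf hf mg hg]; first lra.
have n0R : 0 < n%:R :> R by rewrite ltr0n.
have s0 : 0 < Num.sqrt n%:R :> R by rewrite sqrtr_gt0.
have bf : mbounded f by split => //; exists M.
have bg : mbounded g by split => //; exists M.
have [Sf [ef hSf]] := hC n f n0 mf hf.
have [Sg [eg hSg]] := hC n g n0 mg hg.
have Df := mbounded_raked_dev N n0 bf; have Dg := mbounded_raked_dev N n0 bg.
have Hf := mbounded_raked_lin n N bf; have Hg := mbounded_raked_lin n N bg.
have [bSf Sf0 _] := ef; have [bSg Sg0 _] := eg.
split.
  rewrite -[mean _ _]subr0 -(mean_raked_lin N n0 bf) -(meanB _ Df Hf).
  apply: le_trans (ler_norm_mean _ (mboundedB Df Hf)) _.
  apply: (@le_trans _ _ (mean Pr (fun w => Sf w ^+ 2))).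
    apply: ler_mean => [||w]; [exact: mbounded_norm (mboundedB Df Hf)|exact: mboundedX|].
    by have [] := hSf w.
  apply: le_trans (envelope_sqr n0 ef) _.
  by rewrite ler_wpM2r ?invr_ge0 ?(ltW n0R)//; lra.
rewrite -(mean_raked_lin2 N n0 bf bg).
have DD := mboundedM Df Dg; have HH := mboundedM Hf Hg.
rewrite -(meanB _ DD HH).
apply: le_trans (ler_norm_mean _ (mboundedB DD HH)) _.
have m12 := mboundedM (mboundedX 2 bSf) bSg.
have m21 := mboundedM (mboundedX 2 bSg) bSf.
apply: (@le_trans _ _ (mean Pr (fun w => Sf w ^+ 2 * Sg w + Sg w ^+ 2 * Sf w))).
  apply: ler_mean => [||w]; [exact: mbounded_norm (mboundedB DD HH)|exact: mboundedD|].
  have [_ l1 d1 r1] := hSf w; have [_ l2 d2 r2] := hSg w.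
  rewrite /=; move: l1 d1 r1 l2 d2 r2; set x := X ^~ w.
  set D := raked_dev _ _ _ _ _ f; set H := raked_lin _ _ _ _ _ f.
  set D' := raked_dev _ _ _ _ _ g; set H' := raked_lin _ _ _ _ _ g.
  move=> l1 d1 r1 l2 d2 r2.
  (* In each product one factor is a quadratic remainder and the other a first-order quantity,
     whence the two mixed moments of the envelopes. *)
  rewrite (_ : D * D' - H * H' = (D - H) * D' + (D' - H') * H); last by ring.
  by rewrite (le_trans (ler_normD _ _))// !normrM lerD// ler_pM.
rewrite (meanD _ m12 m21).
apply: (@le_trans _ _ (4 * C / (n%:R * Num.sqrt n%:R))).
  have := envelope_mixed n0 ef eg; have := envelope_mixed n0 eg ef.
  by move: (_^-1) => t; move: (mean _ _) (mean _ _) => a b; lra.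
by rewrite ler_wpM2r ?invr_ge0 ?mulr_ge0 ?ltW//; lra.
Qed.

End raked_moments.

(** * Rates *)

Section rates.
Context (R : realType).

Lemma ln_ge1_near : exists n0 : nat, forall n, (n0 <= n)%N -> 1 <= ln (n%:R : R).
Proof.
exists (Num.truncn (expR 1 : R)).+1 => n hn.
rewrite -ler_expR lnK ?posrE; last by rewrite ltr0n (leq_trans _ hn).
by apply: ltW; apply: lt_le_trans (truncnS_gt _) _; rewrite ler_nat.
Qed.

(** The power of the logarithm is at least 1 as soon as ln n >= 1. The remaining exponent 1/2 -
    alpha is positive because alpha < 1/2. *)
Lemma rate_VC_ge (nu0 : R) : 0 < nu0 -> exists n0 : nat, forall n, (n0 <= n)%N ->
  n%:R `^ (2^-1 - (2 + 5 * nu0)^-1) <= rate_VC nu0 n * Num.sqrt n%:R.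
Proof.
move=> nu; have [n0 hn0] := ln_ge1_near; exists n0.+1 => n hn.
have n1 : 0 < n%:R :> R by rewrite ltr0n (leq_trans _ hn).
rewrite powRB; last by rewrite lt0r_neq0 ?implybT.
rewrite (powR12_sqrt (ltW n1)) /rate_VC /= mulrAC.
rewrite ler_pM2r ?invr_gt0 ?powR_gt0//.
rewrite ler_peMl ?sqrtr_ge0//.
apply: (@le_trans _ _ (1 `^ ((4 + 5 * nu0) / (4 + 10 * nu0)))); first by rewrite powR1.
have l1 : 1 <= ln (n%:R : R) by rewrite hn0// ltnW.
rewrite ge0_ler_powR ?nnegrE ?ler01 ?(le_trans ler01 l1)//.
by rewrite divr_ge0//; lra.
Qed.

(** Half of the exponent of sqrt n is spent on the logarithm: with e = 1 / (4 gamma), e ln n = ln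
    (n^e) <= n^e, and raising to the power gamma gives e^gamma (ln n)^gamma <= n^(1/4). *)
Lemma rate_BR_ge (r0 : R) : 0 < r0 < 1 -> exists c : R, 0 < c /\
  exists n0 : nat, forall n, (n0 <= n)%N ->
  c * n%:R `^ (4^-1) <= rate_BR r0 n * Num.sqrt n%:R.
Proof.
move=> /andP[r00 r01]; rewrite /rate_BR; set gamma := _ / _.
have g0 : 0 < gamma by rewrite divr_gt0//; lra.
clearbody gamma.
pose e := (4 * gamma)^-1; have e0 : 0 < e by rewrite invr_gt0 mulr_gt0.
exists (e `^ gamma); split; first exact: powR_gt0.
have [n0 hn0] := ln_ge1_near; exists n0.+1 => n hn.
have n1 : 0 < n%:R :> R by rewrite ltr0n (leq_trans _ hn).
have l1 : 1 <= ln (n%:R : R) by rewrite hn0// ltnW.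
have l0 : 0 < ln (n%:R : R) by rewrite (lt_le_trans ltr01).
have key : e `^ gamma * ln n%:R `^ gamma <= n%:R `^ (4^-1).
  rewrite -(powRM _ (ltW e0) (ltW l0)) -ln_powR.
  have -> : 4^-1 = e * gamma :> R by rewrite /e; field; rewrite lt0r_neq0.
  rewrite powRrM ge0_ler_powR ?nnegrE ?powR_ge0 ?(ltW g0)//.
    by rewrite ln_powR mulr_ge0 ?(ltW e0) ?(ltW l0).
  by rewrite ltW// ln_sublinear// powR_gt0.
rewrite /= powRN ler_pdivlMl ?powR_gt0// mulrA (mulrC (ln _ `^ _)).
rewrite -(powR12_sqrt (ltW n1)) (_ : 2^-1 = 4^-1 + 4^-1); last by field.
rewrite powRD ?lt0r_neq0 ?implybT// ler_pM2r ?powR_gt0//.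
Qed.

Lemma entropy_rate_dominates d (T : measurableType d) (P : probability T R)
    (F : set (T -> R)) (v : nat -> R) : entropy_rate P F v ->
  forall e : R, 0 < e -> exists n0 : nat, forall n, (n0 <= n)%N ->
    [/\ (0 < n)%N, 0 < v n & (v n * Num.sqrt n%:R)^-1 <= e].
Proof.
move=> hv e e0.
have [c [delta [c0 delta0 [n0 hn0]]]] : exists c delta : R, [/\ 0 < c, 0 < delta &
    exists n0 : nat, forall n, (n0 <= n)%N ->
      c * n%:R `^ delta <= v n * Num.sqrt n%:R].
  case: hv => [[c1 [nu0 [[_ nu _] ->]]]|[b0 [r0 [[_ r01 _] ->]]]].
    exists 1, (2^-1 - (2 + 5 * nu0)^-1); split => //.
      by rewrite subr_gt0 ltf_pV2 ?posrE//; lra.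
    have [n0 h] := rate_VC_ge nu; exists n0 => n hn; rewrite mul1r; exact: h.
  have [c [c0 h]] := rate_BR_ge r01.
  by exists c, 4^-1; split.
(* The solution of c K^delta = 1 / e. *)
pose K := (c * e)^-1 `^ delta^-1.
exists (maxn n0 (Num.truncn K).+1) => n; rewrite geq_max => /andP[n0n Kn].
have npos : (0 < n)%N by exact: leq_trans Kn.
have n1 : 0 < n%:R :> R by rewrite ltr0n.
have s0 : 0 < Num.sqrt n%:R :> R by rewrite sqrtr_gt0.
have h := hn0 n n0n.
have cn : 0 < c * n%:R `^ delta by rewrite mulr_gt0 ?powR_gt0.
have vs : 0 < v n * Num.sqrt n%:R by exact: lt_le_trans h.
split => //; first by rewrite pmulr_lgt0 in vs.
rewrite -[leRHS]invrK lef_pV2 ?posrE ?invr_gt0//.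
apply: le_trans h; rewrite -ler_pdivrMl// -invfM.
have Kn' : K <= n%:R.
  by apply: ltW; apply: lt_le_trans (truncnS_gt _) _; rewrite ler_nat.
have ce : 0 <= (c * e)^-1 by rewrite invr_ge0 mulr_ge0 ?(ltW c0) ?(ltW e0).
have -> : (c * e)^-1 = K `^ delta by rewrite /K -powRrM mulVf ?lt0r_neq0// powRr1.
by apply: (ge0_ler_powR (ltW delta0)) => //; rewrite nnegrE ?(ltW n1)// powR_ge0.
Qed.

End rates.

(** * Upper limits *)

Section limn_esup_bounds.
Context (R : realType).
Implicit Types (u : (\bar R)^nat).
Local Open Scope ereal_scope.

Lemma limn_esup_le_near u (l : \bar R) (n0 : nat) :
  (forall n, (n0 <= n)%N -> u n <= l) -> limn_esup u <= l.
Proof.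
move=> h; apply: (@le_trans _ _ (ereal_sup (u @` [set n | (n0 <= n)%N]))).
  by apply: ereal_inf_lbound; exists [set n | (n0 <= n)%N] => //; exists n0.
by apply: ge_ereal_sup => _ [n /= /h hn <-].
Qed.

Lemma limn_esup_ge_near u (l : \bar R) (n0 : nat) :
  (forall n, (n0 <= n)%N -> l <= u n) -> l <= limn_esup u.
Proof.
move=> h; apply: le_ereal_inf_tmp => _ [V [k _ kV] <-].
apply: (@le_trans _ _ (u (maxn n0 k))); first by rewrite h ?leq_maxl.
by apply: ereal_sup_ubound; exists (maxn n0 k) => //; apply: kV; rewrite /= leq_maxr.
Qed.

Lemma scaled_ereal_sup_le (k b : R) (S : set (\bar R)) : (0 <= k)%R ->
  (forall x, S x -> x <= b%:E) -> k%:E * ereal_sup S <= (k * b)%:E.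
Proof.
move=> k0 h; rewrite EFinM lee_wpmul2l ?lee_fin//.
by apply: ge_ereal_sup => x /h.
Qed.

Lemma scaled_ereal_sup_ge0 (k : R) (S : set (\bar R)) x : (0 <= k)%R ->
  S x -> 0 <= x -> 0 <= k%:E * ereal_sup S.
Proof.
move=> k0 Sx x0; rewrite mule_ge0 ?lee_fin//.
by apply: le_trans x0 _; exact: ereal_sup_ubound.
Qed.

Lemma dominated_limn_esup_le0 u (v : nat -> R) (C : R) : (0 <= C)%R ->
  (forall e : R, (0 < e)%R -> exists n0 : nat, forall n, (n0 <= n)%N ->
    [/\ (0 < n)%N, (0 < v n)%R & ((v n * Num.sqrt n%:R)^-1 <= e)%R]) ->
  (forall n, (0 < n)%N -> (0 < v n)%R -> u n <= (C / (v n * Num.sqrt n%:R))%:E) ->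
  limn_esup u <= 0.
Proof.
move=> C0 hv hu; apply/lee_addgt0Pr => e e0; rewrite add0e.
have C1 : (0 < C + 1)%R by rewrite ltr_wpDl.
(* Division by C + 1 rather than C, which may be 0. *)
have [n0 h] := hv _ (divr_gt0 e0 C1); apply: (@limn_esup_le_near _ _ n0) => n hn.
have [npos vpos ve] := h n hn; apply: le_trans (hu _ npos vpos) _; rewrite lee_fin.
apply: (@le_trans _ _ (C * (e / (C + 1)))%R); first by rewrite ler_wpM2l.
by rewrite mulrCA ger_pMr// ler_pdivrMr// mul1r lerDl.
Qed.

End limn_esup_bounds.

(** * Square integrability and covariance of the Brownian bridge *)

Section brownian_bridge_moments.
Context (R : realType) d dO (T : measurableType d) (O : measurableType dO).
Context (P : probability T R) (Pr : probability O R).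
Context (F : set (T -> R)) (G : (T -> R) -> O -> R).
Context (hG : brownian_bridge Pr P F G).

(** As G f is centered, the prescribed finite value of its covariance with itself is the integral of
    its square. Measurability comes from the Gaussian property for a one-term combination. *)
Lemma brownian_bridge_Lfun2 f : F f -> G f \in Lfun Pr 2%:E.
Proof.
move=> Ff; have [gauss _ mean0 cov] := hG.
have mG : measurable_fun setT (G f).
  have [+ _] := gauss 1%N (fun=> 1) (fun=> f) (fun=> Ff).
  by under eq_fun do rewrite big_ord_recl big_ord0 mul1r addr0.
rewrite inE; apply/andP; split; rewrite inE//= /finite_norm unlock poweR_lty//.
have := cov f f Ff Ff; rewrite unlock mean0//= unlock => h.
rewrite (_ : (\int[Pr]_x _)%E = (mean P (f \* f) - mean P f * mean P f)%:E) ?ltry//.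
rewrite -h; apply: eq_integral => w _ /=.
rewrite powR_mulrn// -normrX ger0_norm ?sqr_ge0// expr2; congr EFin.
by rewrite /GRing.mul /= subr0.
Qed.

Lemma covariance_brownian_bridge f g : F f -> F g ->
  covariance Pr (G f) (G g) = (bridge_cov P f g)%:E.
Proof. by move=> Ff Fg; have [_ _ _ cov] := hG; exact: cov. Qed.

End brownian_bridge_moments.

(** * Bias and covariance of the raked measure in terms of its deviations *)

Section raked_statistics.
Context (R : realType) d dO (T : measurableType d) (O : measurableType dO).
Context (P : probability T R) (Pr : probability O R) (X : nat -> {RV Pr >-> T}).
Context (m : nat -> nat) (A : forall N, 'I_(m N) -> set T).
Context (hA : partition_sequence P A).

Local Notation Q n N f := (fun w => raked P A n (X ^~ w) N f).
Local Notation D n N f := (fun w => raked_dev P A n (X ^~ w) N f).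

Lemma mean_raked_dev n N f : (0 < n)%N -> mbounded f ->
  mean Pr (D n N f) = mean Pr (Q n N f) - mean P f.
Proof.
move=> n0 mf.
by rewrite (meanB _ (mbounded_raked X hA N n0 mf) (mbounded_cst (mean P f))) mean_cst.
Qed.

Lemma expectation_raked_bias n N f : (0 < n)%N -> mbounded f ->
  ('E_Pr[Q n N f] - (mean P f)%:E = (mean Pr (D n N f))%:E)%E.
Proof.
by move=> n0 mf; rewrite expectation_mbounded ?mean_raked_dev//; exact: mbounded_raked.
Qed.

Lemma covariance_raked n N f g : (0 < n)%N -> mbounded f -> mbounded g ->
  covariance Pr (Q n N f) (Q n N g)
  = (mean Pr (fun w => D n N f w * D n N g w)
     - mean Pr (D n N f) * mean Pr (D n N g))%:E.
Proof.
move=> n0 mf mg.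
have mQ h : mbounded h -> mbounded (Q n N h) by exact: mbounded_raked.
rewrite (covariance_mbounded _ (mQ _ mf) (mQ _ mg)) !mean_raked_dev//.
have QQ := mboundedM (mQ _ mf) (mQ _ mg).
have Qf := mboundedZ (mean P g) (mQ _ mf); have Qg := mboundedZ (mean P f) (mQ _ mg).
have c := mbounded_cst (d := dO) (T := O) (mean P f * mean P g).
transitivity (mean Pr (Q n N f \* Q n N g)
    - mean Pr (Q n N f) * mean Pr (Q n N g))%:E => //.
congr EFin.
rewrite [X in _ = X - _](_ : _ = mean Pr (fun w =>
    ((Q n N f w * Q n N g w - mean P g * Q n N f w) - mean P f * Q n N g w)
    + mean P f * mean P g)); last first.
  by apply: eq_Rintegral => w _; rewrite /raked_dev; ring.
rewrite (meanD _ (mboundedB (mboundedB QQ Qf) Qg) c) (meanB _ (mboundedB QQ Qf) Qg).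
rewrite (meanB _ QQ Qf) (meanZ _ _ (mQ _ mf)) (meanZ _ _ (mQ _ mg)) mean_cst.
ring.
Qed.

End raked_statistics.

Theorem proposition5 (R : realType)
  (d : measure_display) (T : measurableType d) (P : probability T R)
  (m : nat -> nat) (A : forall N : nat, 'I_(m N) -> set T)
  (hA : partition_sequence P A)
  (N0 : nat) (F : set (T -> R)) (M : R)
  (hFbounded : forall f, F f -> forall x, `|f x| <= M)
  (hFmeasurable : pointwise_measurable F)
  (hFstable : stable_under_cells A N0 F)
  (v : nat -> R) (hv : entropy_rate P F v)
  (d0 theta0 : R) (hd0 : 0 < d0) (htheta0 : 0 < theta0)
  (happrox : strong_approximation P A N0 F v d0 theta0)
  (dO : measure_display) (O : measurableType dO) (Pr : probability O R)
  (X : nat -> {RV Pr >-> T}) (hX : iid P X)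
  (dG : measure_display) (OG : measurableType dG) (PG : probability OG R)
  (G : (T -> R) -> OG -> R) (hG : brownian_bridge PG P F G) :
  (limn_esup (fun n : nat =>
     (Num.sqrt n%:R / v n)%:E *
     \big[maxe/-oo]_(N < N0.+1)
       ereal_sup [set `| 'E_Pr[(fun w => raked P A n (X ^~ w) N f)]
                         - (Rintegral P setT f)%:E | | f in F])
   <= d0%:E)%E
  /\
  forall N : nat, (N <= N0)%N ->
    (limn_esup (fun n : nat =>
       (n%:R / v n)%:E *
       ereal_sup [set `| 'E_Pr[(fun w =>
                            (raked P A n (X ^~ w) N f - Rintegral P setT f)
                            * (raked P A n (X ^~ w) N g - Rintegral P setT g))%R]
                         - (n%:R^-1)%:E
                           * covariance PG (raked_bridge P A G N f)
                                           (raked_bridge P A G N g) |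
                 | f in F & g in F])
     = limn_esup (fun n : nat =>
       (n%:R / v n)%:E *
       ereal_sup [set `| covariance Pr (fun w => raked P A n (X ^~ w) N f)
                                       (fun w => raked P A n (X ^~ w) N g)
                         - (n%:R^-1)%:E
                           * covariance PG (raked_bridge P A G N f)
                                           (raked_bridge P A G N g) |
                 | f in F & g in F]))%E
    /\
    (limn_esup (fun n : nat =>
       (n%:R / v n)%:E *
       ereal_sup [set `| covariance Pr (fun w => raked P A n (X ^~ w) N f)
                                       (fun w => raked P A n (X ^~ w) N g)
                         - (n%:R^-1)%:E
                           * covariance PG (raked_bridge P A G N f)
                                           (raked_bridge P A G N g) |
                 | f in F & g in F])
     <= (Num.sqrt (8 / pi) * d0 * sigma_class P F)%:E)%E.
Proof.
(* The cell indicators have to obey the same bound as the functions of F. *)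
pose M1 := Num.max M 1.
have M11 : 1 <= M1 by rewrite /M1 le_max lexx orbT.
have hM f : F f -> forall y, `|f y| <= M1.
  by move=> Ff y; rewrite (le_trans (hFbounded f Ff y))// /M1 le_max lexx.
have hm f : F f -> measurable_fun setT f by exact: hFmeasurable.1.
have mb f : F f -> mbounded f by move=> Ff; split; [exact: hm|exists M1; exact: hM].
have hv' := entropy_rate_dominates hv.
have /choice[C hC] : forall N, exists C : R, 0 <= C /\
    forall n (f g : T -> R), (0 < n)%N -> F f -> F g ->
    `|mean Pr (fun w => raked_dev P A n (X ^~ w) N f)| <= C / n%:R /\
    `|mean Pr (fun w => raked_dev P A n (X ^~ w) N f * raked_dev P A n (X ^~ w) N g)
      - n%:R^-1 * raked_form P A (bridge_cov P) N f g| <= C / (n%:R * Num.sqrt n%:R).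
  move=> N; have [C C0 h] := raked_moments hX hA N M11.
  exists C; split=> // n f g n0 Ff Fg.
  exact: h n0 (hm f Ff) (hM f Ff) (hm g Fg) (hM g Fg).
split.
  (* The sum dominates the constant of every stage, hence controls the maximum over N. *)
  pose CC := \sum_(N < N0.+1) C N.
  have CC0 : 0 <= CC by apply: sumr_ge0 => N _; exact: (hC N).1.
  apply: le_trans (_ : (0 <= d0%:E)%E); last by rewrite lee_fin ltW.
  apply: (dominated_limn_esup_le0 CC0 hv') => n n0 vn.
  have n0R : 0 < n%:R :> R by rewrite ltr0n.
  have s0 : 0 < Num.sqrt n%:R :> R by rewrite sqrtr_gt0.
  have -> : CC / (v n * Num.sqrt n%:R) = Num.sqrt n%:R / v n * (CC / n%:R).
    by rewrite -[X in _ = _ * (_ / X)](sqr_sqrtr (ltW n0R)); field; rewrite !lt0r_neq0.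
  rewrite [leRHS]EFinM lee_wpmul2l ?lee_fin ?divr_ge0 ?(ltW s0) ?(ltW vn)//.
  apply: bigmax_le; first exact: leNye.
  move=> N _; apply: ge_ereal_sup => _ [f Ff <-].
  rewrite (expectation_raked_bias _ hA _ n0 (mb f Ff)) abse_EFin lee_fin.
  have [h _] := (hC N).2 n f f n0 Ff Ff; apply: le_trans h _.
  rewrite ler_wpM2r ?invr_ge0 ?ler0n// /CC (bigD1 N)//= lerDl.
  by apply: sumr_ge0 => k _; exact: (hC k).1.
move=> N NN0.
have FA k : (1 <= k <= N)%N -> forall j, F \1_(A k j).
  move=> /andP[k1 kN] j; apply: (hFstable k _ j).1.
  by rewrite k1 (leq_trans kN).
have covG f g : F f -> F g -> covariance PG (raked_bridge P A G N f)
    (raked_bridge P A G N g) = (raked_form P A (bridge_cov P) N f g)%:E.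
  apply: (@covariance_raked_bridge _ _ _ P m A _ _ PG F G) => //.
  - by move=> h; exact: (brownian_bridge_Lfun2 hG).
  - by move=> h k; exact: (covariance_brownian_bridge hG).
have rhs0 : (0 <= (Num.sqrt (8 / pi) * d0 * sigma_class P F)%:E)%E.
  by rewrite lee_fin !mulr_ge0 ?sqrtr_ge0 ?(ltW hd0).
have [C0 hCN] := hC N.
set u1 := fun n : nat => (_ * ereal_sup [set _ | f in F & g in F])%E.
set u2 := fun n : nat => (_ * ereal_sup [set `|covariance _ _ _ - _| | f in F & g in F])%E.
pose D n f := fun w => raked_dev P A n (X ^~ w) N f.
have t1E n f g : (0 < n)%N -> F f -> F g ->
  (`|'E_Pr[(fun w => (raked P A n (X ^~ w) N f - mean P f) *
      (raked P A n (X ^~ w) N g - mean P g))%R]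
    - n%:R^-1%:E * covariance PG (raked_bridge P A G N f) (raked_bridge P A G N g)|
  = (`|mean Pr (fun w => D n f w * D n g w)
      - n%:R^-1 * raked_form P A (bridge_cov P) N f g|)%:E)%E.
  move=> n0 Ff Fg; rewrite covG// expectation_mbounded//.
  have mD h : F h -> mbounded (D n h).
    by move=> Fh; apply: (mbounded_raked_dev _ hA _ n0); exact: mb.
  exact: mboundedM (mD f Ff) (mD g Fg).
have t2E n f g : (0 < n)%N -> F f -> F g ->
  (`|covariance Pr (fun w => raked P A n (X ^~ w) N f) (fun w => raked P A n (X ^~ w) N g)
    - n%:R^-1%:E * covariance PG (raked_bridge P A G N f) (raked_bridge P A G N g)|
  = (`|mean Pr (fun w => D n f w * D n g w) - mean Pr (D n f) * mean Pr (D n g)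
      - n%:R^-1 * raked_form P A (bridge_cov P) N f g|)%:E)%E.
  move=> n0 Ff Fg; rewrite covG//.
  by rewrite (covariance_raked _ hA _ n0 (mb f Ff) (mb g Fg)).
(* The square accounts for the product of the two biases, at most (C / n)^2, by which the covariance
   differs from the mean product; n^2 dominates n sqrt n. *)
pose CC := C N + C N ^+ 2.
have CC0 : 0 <= CC by rewrite addr_ge0// sqr_ge0.
have scale n : (0 < n)%N -> 0 < v n ->
    CC / (v n * Num.sqrt n%:R) = n%:R / v n * (CC / (n%:R * Num.sqrt n%:R)).
  move=> n0 vn; have n0R : 0 < n%:R :> R by rewrite ltr0n.
  have s0 : 0 < Num.sqrt n%:R :> R by rewrite sqrtr_gt0.
  by field; rewrite !lt0r_neq0.
have le1 : (limn_esup u1 <= 0)%E.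
  apply: (dominated_limn_esup_le0 CC0 hv') => n n0 vn; rewrite scale//.
  apply: scaled_ereal_sup_le; first by rewrite divr_ge0 ?ler0n ?ltW.
  move=> _ [f Ff [g Fg <-]]; rewrite t1E// lee_fin.
  apply: le_trans (hCN n f g n0 Ff Fg).2 _.
  by rewrite ler_wpM2r ?invr_ge0 ?mulr_ge0 ?ler0n ?sqrtr_ge0// lerDl sqr_ge0.
have le2 : (limn_esup u2 <= 0)%E.
  apply: (dominated_limn_esup_le0 CC0 hv') => n n0 vn; rewrite scale//.
  apply: scaled_ereal_sup_le; first by rewrite divr_ge0 ?ler0n ?ltW.
  move=> _ [f Ff [g Fg <-]]; rewrite t2E// lee_fin.
  have n0R : 0 < n%:R :> R by rewrite ltr0n.
  have sn : Num.sqrt n%:R <= n%:R :> R.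
    rewrite -[leRHS](sqr_sqrtr (ltW n0R)) expr2 ler_peMr ?sqrtr_ge0//.
    by rewrite -[leLHS]sqrtr1 ler_wsqrtr// ler1n.
  have s0 : 0 < Num.sqrt n%:R :> R by rewrite sqrtr_gt0.
  rewrite addrAC (le_trans (ler_normB _ _))// mulrDl lerD ?(hCN n f g n0 Ff Fg).2//.
  apply: (@le_trans _ _ ((C N / n%:R) * (C N / n%:R))).
    by rewrite normrM ler_pM// ?(hCN n f g n0 Ff Fg).1// (hCN n g f n0 Fg Ff).1.
  rewrite mulrACA -expr2 -invfM ler_wpM2l ?sqr_ge0// lef_pV2 ?posrE ?mulr_gt0//.
  by rewrite ler_pM2l.
(* For empty F the suprema are over the empty set and the two sequences coincide. Otherwise the
   suprema are nonnegative, so both upper limits are 0. *)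
have [F0|/set0P[h Fh]] := eqVneq F set0.
  have -> : u1 = u2.
    apply/funext => n; rewrite /u1 /u2; congr (_ * ereal_sup _)%E.
    by rewrite F0; apply/seteqP; split => x [f []].
  by split => //; exact: le_trans rhs0.
have ge1 : (0 <= limn_esup u1)%E.
  have [n0 hn0] := hv' _ ltr01; apply: (@limn_esup_ge_near _ _ _ n0) => n /hn0[npos vn _].
  apply: scaled_ereal_sup_ge0; first by rewrite divr_ge0 ?ler0n ?ltW.
    by exists h => //; exists h.
  exact: abse_ge0.
have ge2 : (0 <= limn_esup u2)%E.
  have [n0 hn0] := hv' _ ltr01; apply: (@limn_esup_ge_near _ _ _ n0) => n /hn0[npos vn _].
  apply: scaled_ereal_sup_ge0; first by rewrite divr_ge0 ?ler0n ?ltW.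
    by exists h => //; exists h.
  exact: abse_ge0.
split; last exact: le_trans rhs0.
by apply/eqP; rewrite eq_le (le_trans le1 ge2) (le_trans le2 ge1).
Qed.
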